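(* Let $\Omega$ be a body in $\mathbb{R}^m$. (1) The origin is a critical point of $V_\Omega^{(\alpha)}$ for any $\alpha>1$ if and only if the body $\Omega$ satisfies the balance law at the origin. (2) Suppose that the origin is not on the boundary of $\Omega$. The origin is a critical point of $V_\Omega^{(\alpha)}$ for any $\alpha\notin[0,1]$ (i.e. for any $\alpha\in\mathbb{R}\setminus[0,1]$) if and only if the body $\Omega$ satisfies the balance law at the origin. (3) Suppose that $\Omega$ has a piecewise $C^1$ boundary, and that the origin is not on the boundary of $\Omega$. The origin is a critical point of $V_\Omega^{(\alpha)}$ for any $\alpha\in\mathbb{R}$ if and only if the body $\Omega$ satisfies the balance law at the origin.
   Context: A body in $\mathbb{R}^m$ is the closure of a bounded open set. $S^{m-1}$ is the unit sphere of $\mathbb{R}^m$, $rS^{m-1}$ the sphere of radius $r$ centered at the origin, $B_\varepsilon(x)$ the closed ball of radius $\varepsilon$ centered at $x$, $\sigma$ denotes $(m-1)$-dimensional surface measure, $\Omega^\circ$ the interior and $\Omega^c$ the complement of $\Omega$. Balance law: $\Omega$ satisfies the balance law at the origin if $\int_{rS^{m-1}\cap\Omega} v\,d\sigma(v)=0$ for any $r\ge 0$. The $r^{\alpha-m}$-potential $V_\Omega^{(\alpha)}$ of order $\alpha\in\mathbb{R}$ is defined as follows. - If $0<\alpha\neq m$: $V_\Omega^{(\alpha)}(x)=\operatorname{sign}(m-\alpha)\int_\Omega |x-y|^{\alpha-m}\,dy$, $x\in\mathbb{R}^m$. - If $\alpha=m$: $V_\Omega^{(m)}(x)=-\int_\Omega\log|x-y|\,dy$,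 $x\in\mathbb{R}^m$. - If $\alpha=0$: $V_\Omega^{(0)}(x)=\lim_{\varepsilon\to0^+}\left(\int_{\Omega\setminus B_\varepsilon(x)}|x-y|^{-m}\,dy-\sigma(S^{m-1})\log\frac1\varepsilon\right)$ for $x\in\Omega^\circ$, and $V_\Omega^{(0)}(x)=\int_\Omega|x-y|^{-m}\,dy$ for $x\in\Omega^c$. - If $\alpha<0$: $V_\Omega^{(\alpha)}(x)=\lim_{\varepsilon\to0^+}\left(\int_{\Omega\setminus B_\varepsilon(x)}|x-y|^{\alpha-m}\,dy-\frac{\sigma(S^{m-1})}{-\alpha}\frac{1}{\varepsilon^{-\alpha}}\right)$ for $x\in\Omega^\circ$, and $V_\Omega^{(\alpha)}(x)=\int_\Omega|x-y|^{\alpha-m}\,dy$ for $x\in\Omega^c$. A critical point is a point at which the function is differentiable and its gradient vanishes.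
   Formalization: The balance law is required for almost every r ≥ 0 instead of any r ≥ 0; with every r, the ''only if'' halves fail, e.g. for a planar body of three symmetric sectors in 1/2≤|x|≤1 and two antipodal sectors in 1≤|x|≤2, where balance fails only at r = 1. *)

(* Defs.v *)
From HB Require Import structures.
From mathcomp Require Import all_boot all_order all_algebra.
From mathcomp Require Import all_classical all_reals all_analysis.
From mathcomp Require Import measurable_realfun.

Set Implicit Arguments.
Unset Strict Implicit.
Unset Printing Implicit Defensive.

Import Order.TTheory GRing.Theory Num.Theory.
Import numFieldNormedType.Exports.

Local Open Scope classical_set_scope.
Local Open Scope ring_scope.

(* R^m is 'rV[R]_m.  MathComp-Analysis equips it with the sup norm, which gives
   the usual topology and notion of differentiability; all lengths in the
   potentials, balls and spheres below are Euclidean. *)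
Definition enorm (R : realType) (m : nat) (x : 'rV[R]_m) : R :=
  Num.sqrt (\sum_(i < m) x 0 i ^+ 2).

Section measurable_rV.
Context (R : realType) (m : nat).

Definition rV_coord (i : 'I_m) (x : 'rV[R]_m) : measurableTypeR R := x 0 i.

Let rV_set0 : g_sigma_preimage rV_coord set0.
Proof. exact: sigma_algebra0. Qed.

Let rV_setC A : g_sigma_preimage rV_coord A -> g_sigma_preimage rV_coord (~` A).
Proof. exact: sigma_algebraC. Qed.

Let rV_bigcup (F : (set 'rV[R]_m)^nat) :
  (forall i, g_sigma_preimage rV_coord (F i)) ->
  g_sigma_preimage rV_coord (\bigcup_i F i).
Proof. exact: sigma_algebra_bigcup. Qed.

(* The product (= Borel) sigma-algebra, as the library does for tuples. *)
HB.instance Definition _ := @isMeasurable.Build default_measure_display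
  'rV[R]_m (g_sigma_preimage rV_coord) rV_set0 rV_setC rV_bigcup.

Lemma measurable_rV_coord (i : 'I_m) : measurable_fun [set: 'rV[R]_m] (rV_coord i).
Proof.
move=> _ Y mY; rewrite setTI; apply: sub_sigma_algebra => /=.
rewrite -bigcup_seq/=; exists i => /=; first by rewrite mem_index_enum.
by exists Y => //; rewrite setTI.
Qed.

End measurable_rV.

Lemma measurable_fun_rVP d (T : measurableType d) (R : realType) (m : nat)
    (f : T -> 'rV[R]_m) :
  (forall i, measurable_fun [set: T] (@rV_coord R m i \o f)) ->
  measurable_fun [set: T] f.
Proof.
move=> mf.
have H : g_sigma_preimage (fun i => @rV_coord R m i \o f) `<=` measurable.
  apply: smallest_sub; first exact: sigma_algebra_measurable.
  case: m f mf => [|n] f mf; first by rewrite big_ord0.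
  rewrite -bigcup_mkord_ord; apply: bigcup_sub => i Ii.
  by move=> A [B mB <-]; exact: mf.
by move=> _ A mA; apply: H; rewrite g_sigma_preimage_comp; exists A.
Qed.

Section lebesgue_rV.
Context (R : realType).

Definition rV_cons (m : nat) (p : measurableTypeR R * 'rV[R]_m) : 'rV[R]_m.+1 :=
  row_mx (p.1 : R)%:M p.2 : 'rV[R]_(1 + m).

Lemma rV_consEl (m : nat) p : @rV_cons m p 0 (lshift m 0 : 'I_(1 + m)) = p.1.
Proof.
by rewrite [LHS](row_mxEl ((p.1 : R)%:M : 'M[R]_1) p.2) mxE.
Qed.

Lemma rV_consEr (m : nat) p j : @rV_cons m p 0 (rshift 1 j) = p.2 0 j.
Proof. exact: (row_mxEr ((p.1 : R)%:M : 'M[R]_1)). Qed.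

Lemma measurable_rV_cons (m : nat) : measurable_fun setT (@rV_cons m).
Proof.
apply: measurable_fun_rVP => i.
case: (split_ordP (i : 'I_(1 + m))) => j ->.
  rewrite (_ : _ \o _ = fst)//; apply/funext => p /=.
  by rewrite /rV_coord ord1 rV_consEl.
rewrite (_ : _ \o _ = rV_coord j \o snd).
  by apply: measurableT_comp => //; exact: measurable_rV_coord.
by apply/funext => p /=; rewrite /rV_coord rV_consEr.
Qed.

Definition rV_uncons (m : nat) (x : 'rV[R]_m.+1) : measurableTypeR R * 'rV[R]_m :=
  (rV_coord 0 x, rsubmx (x : 'rV[R]_(1 + m))).

Lemma measurable_rV_uncons (m : nat) : measurable_fun setT (@rV_uncons m).
Proof.
apply/measurable_fun_pairP; split; first exact: measurable_rV_coord.
apply: measurable_fun_rVP => i.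
rewrite (_ : _ \o _ = @rV_coord R m.+1 (rshift 1 i)).
  exact: measurable_rV_coord.
by apply/funext => x; rewrite /rV_coord /= mxE.
Qed.

Lemma rV_consK (m : nat) : cancel (@rV_cons m) (@rV_uncons m).
Proof.
move=> [a y]; rewrite /rV_uncons /rV_cons row_mxKr /rV_coord; congr pair.
have /= := rV_consEl (a, y); rewrite /rV_cons/= => {2}<-.
by congr (row_mx _ _ _ _); exact/val_inj.
Qed.

Section cons_measure.
Context (m : nat) (mu : {sigma_finite_measure set 'rV[R]_m -> \bar R}).

Definition cons_measure : set 'rV[R]_m.+1 -> \bar R :=
  pushforward (@lebesgue_measure R \x mu)%E (@rV_cons m).

HB.instance Definition _ := Measure.copy cons_measure
  (measure_function_pushforward__canonical__measure_function_Measure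
     (@lebesgue_measure R \x mu)%E (@measurable_rV_cons m)).

Let cons_measure_sigma_finite : sigma_finite setT cons_measure.
Proof.
have /sigma_finiteP[F [TF ndF Foo]] := sigma_finiteT (@lebesgue_measure R).
have /sigma_finiteP[G [TG ndG Goo]] := sigma_finiteT mu.
exists (fun k => @rV_uncons m @^-1` (F k `*` G k)).
  rewrite -preimage_bigcup -[LHS](@preimage_setT _ _ (@rV_uncons m)).
  congr (_ @^-1` _); rewrite -setXTT TF TG predeqE => -[x y]; split.
    move=> [/= [n _ Fnx] [k _ Gky]]; exists (maxn n k) => //; split.
    - by move: x Fnx; exact/subsetPset/ndF/leq_maxl.
    - by move: y Gky; exact/subsetPset/ndG/leq_maxr.
  by move=> [n _ []/= ? ?]; split; exists n.
move=> k; have [mF Fk] := Foo k; have [mG Gk] := Goo k; split.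
  rewrite -[X in measurable X]setTI; apply: measurable_rV_uncons => //.
  exact: measurableX.
rewrite /cons_measure /pushforward -comp_preimage.
rewrite (_ : _ \o _ = id) ?preimage_id; last by apply/funext => p; exact: rV_consK.
by rewrite product_measure1E// lte_mul_pinfty// ge0_fin_numE.
Qed.

HB.instance Definition _ := Measure_isSigmaFinite.Build _ _ _ cons_measure
  cons_measure_sigma_finite.

End cons_measure.

(* R^0 is a point of mass 1, and R^(m+1) = R * R^m. *)
Fixpoint lebesgue_rV (m : nat) : {sigma_finite_measure set 'rV[R]_m -> \bar R} :=
  match m with
  | 0 => \d_(0 : 'rV[R]_0)
  | m'.+1 => cons_measure (lebesgue_rV m')
  end.

End lebesgue_rV.

Section surface_measure.
Context (R : realType) (m : nat).

Definition esphere (r : R) : set 'rV[R]_m := [set x | enorm x = r].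

(* closed Euclidean ball *)
Definition eball (x : 'rV[R]_m) (eps : R) : set 'rV[R]_m :=
  [set y | enorm (x - y) <= eps].

(* The radial projection of R^m \ {0} onto the sphere of radius r. *)
Definition radial (r : R) (x : 'rV[R]_m) : 'rV[R]_m := (r / enorm x) *: x.

Definition punctured_eball : set 'rV[R]_m := [set x | 0 < enorm x <= 1].

Lemma measurable_rV_entry (i : 'I_m) : measurable_fun setT (fun x : 'rV[R]_m => x 0 i).
Proof. exact: measurable_rV_coord. Qed.
#[local] Hint Resolve measurable_rV_entry : core.

Lemma measurable_enorm : measurable_fun [set: 'rV[R]_m] (@enorm R m).
Proof.
apply: (@measurableT_comp _ _ _ _ _ _ (@Num.sqrt R)).
  apply: continuous_measurable_fun; exact: sqrt_continuous.
by apply: measurable_sum => i; exact: measurable_funX.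
Qed.

Lemma measurable_punctured_eball : measurable punctured_eball.
Proof.
rewrite (_ : punctured_eball = @enorm R m @^-1` `]0, 1]%classic).
  by rewrite -[X in measurable X]setTI; apply: measurable_enorm.
by apply/seteqP; split => x; rewrite /punctured_eball /= in_itv.
Qed.

Lemma measurable_radial (r : R) : measurable_fun setT (radial r).
Proof.
apply: measurable_fun_rVP => i.
rewrite (_ : _ \o _ =
    (fun x : 'rV[R]_m => r * enorm x `^ (-1) * x 0 i)).
  apply: measurable_funM => //; apply: measurable_funM => //.
  apply: (@measurableT_comp _ _ _ _ _ _ (@powR R ^~ (-1))) => //.
  exact: measurable_enorm.
by apply/funext => x; rewrite /rV_coord /= mxE powR_inv1// sqrtr_ge0.
Qed.

(* The (m-1)-dimensional surface measure on the sphere of radius r > 0 (extended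
   by 0 off the sphere), by the usual cone construction:
     sigma_r(A) = r^(m-1) * m * vol {x | 0 < |x| <= 1, r x / |x| \in A}. *)
Definition surface_measure (r : R) : set 'rV[R]_m -> \bar R :=
  pushforward
    (mscale (m%:R * `|r| ^+ m.-1)%:nng
       (mrestr (lebesgue_rV R m) measurable_punctured_eball))
    (radial r).

HB.instance Definition _ (r : R) := Measure.copy (surface_measure r)
  (measure_function_pushforward__canonical__measure_function_Measure
     (mscale (m%:R * `|r| ^+ m.-1)%:nng
        (mrestr (lebesgue_rV R m) measurable_punctured_eball))
     (measurable_radial r)).

(* sigma(S^(m-1)) *)
Definition sphere_area : R := fine (surface_measure 1 (esphere 1)).

End surface_measure.
Arguments esphere {R m}.
Arguments surface_measure {R} m r.
Arguments sphere_area : clear implicits.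

Section potential.
Context (R : realType) (m : nat) (Om : set 'rV[R]_m).

Definition riesz_integral (alpha : R) (D : set 'rV[R]_m) (x : 'rV[R]_m) : R :=
  \int[lebesgue_rV R m]_(y in D) (enorm (x - y) `^ (alpha - m%:R)).

(* The divergent part of riesz_integral alpha (Om `\` eball x eps) x, for
   alpha <= 0 and x an interior point. *)
Definition counterterm (alpha eps : R) : R :=
  if alpha == 0 then sphere_area R m * ln (1 / eps)
  else sphere_area R m / (- alpha) * (1 / eps `^ (- alpha)).

(* For alpha <= 0 the potential is only meaningful off the boundary of Om; at
   boundary points the value below is a dummy. *)
Definition potential (alpha : R) (x : 'rV[R]_m) : R :=
  if 0 < alpha then
    if alpha == m%:R then - \int[lebesgue_rV R m]_(y in Om) ln (enorm (x - y))
    else Num.sg (m%:R - alpha) * riesz_integral alpha Om x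
  else
    if `[< Om° x >] then
      lim ((riesz_integral alpha (Om `\` eball x eps) x - counterterm alpha eps)
             @[eps --> 0^'+])
    else riesz_integral alpha Om x.

(* For each radius r, the vector equation
     \int_(rS^(m-1) \cap Om) v dsigma(v) = 0, coordinate by coordinate. *)
Definition balanced_at (r : R) : Prop :=
  forall i : 'I_m,
    \int[surface_measure m r]_(v in esphere r `&` Om) v 0 i = 0.

(* "For any r" has to be read up to a null set of radii: the potentials do not
   see a null set of spheres.  For instance, in the plane let Om consist of the
   points with 1/2 <= |x| <= 1 whose argument is within 1/10 of 0, 2pi/3 or
   4pi/3, and of those with 1 <= |x| <= 2 whose argument is within 1/10 of 0 or
   pi.  The origin is a critical point of every potential of Om and Om is
   balanced at every r != 1, but not at r = 1. *)
Definition balance_law : Prop :=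
  {ae @lebesgue_measure R, forall r : R, 0 <= r -> balanced_at r}.

End potential.

Definition critical_point (R : realType) (m : nat) (f : 'rV[R]_m -> R)
    (x : 'rV[R]_m) : Prop :=
  differentiable f x /\ forall i : 'I_m, 'D_(delta_mx 0 i) f x = 0.

Definition body (R : realType) (m : nat) (Om : set 'rV[R]_m) : Prop :=
  exists U : set 'rV[R]_m, [/\ open U, bounded_set U & Om = closure U].

Definition boundary (T : topologicalType) (A : set T) : set T :=
  closure A `\` A°.

Section piecewise_C1.
Context (R : realType) (m : nat).

Definition C1_on (n : nat) (U : set 'rV[R]_n) (f : 'rV[R]_n -> 'rV[R]_m) :=
  forall x, U x -> differentiable f x /\
    forall v, {for x, continuous (fun y => 'd f y v)}.

Definition unit_cube (n : nat) : set 'rV[R]_n :=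
  [set u | forall i, 0 <= u 0 i <= 1].

Definition open_unit_cube (n : nat) : set 'rV[R]_n :=
  [set u | forall i, 0 < u 0 i < 1].

Arguments unit_cube n : clear implicits.
Arguments open_unit_cube n : clear implicits.

(* S is a finite union of C^1 patches parametrized by [0,1]^(m-1); each patch is
   a C^1 hypersurface in its relative interior, and patches meet each other (and
   themselves) only along the images of the faces of the cube.  Regularity is
   not required on the faces, so that cones and the spherical coordinates of a
   sphere are allowed. *)
Definition piecewise_C1 (S : set 'rV[R]_m) : Prop :=
  exists (k : nat) (phi : 'I_k -> 'rV[R]_m.-1 -> 'rV[R]_m),
    [/\ forall i, exists U, [/\ open U, unit_cube m.-1 `<=` U & C1_on U (phi i)],
        forall i u, open_unit_cube m.-1 u -> injective ('d (phi i) u),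
        forall i j u w, open_unit_cube m.-1 u -> unit_cube m.-1 w ->
          phi i u = phi j w -> i = j /\ u = w
      & S = \bigcup_(i in [set: 'I_k]) (phi i @` unit_cube m.-1)].

End piecewise_C1.

(* Main.v *)
(* Near the origin and up to an additive constant, the potential of order alpha is
   a multiple of the integral over Om of k(|x - y|), with k(r) = r^(alpha - m) or
   log r.  If the origin is not on the boundary, k may be replaced by an extension
   that is smooth through the singularity: for an exterior origin the singularity
   is not seen, and for an interior one the change amounts to an integral over a
   whole ball around x, which is independent of x once the counterterm is
   subtracted.  If alpha > 1, both k and its gradient are integrable.  In each case
   one differentiates under the integral, and the gradient at the origin is the
   integral over Om of psi(|y|) y for some radial weight psi.  In polar coordinates
   this vanishes under the balance law.

   Conversely, alpha = m + 2n + 2 gives \int_Om |y|^(2n) y dy = 0, so all even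
   moments of r |-> \int_(rS \cap Om) v dsigma(v), which lives on a segment [0, M],
   vanish.  Expanding exp (-(r/c)^(2N)) in even powers and letting N tend to
   infinity, the integral of this function over [0, c] vanishes for every c, and
   the Lebesgue differentiation theorem shows that it vanishes almost everywhere. *)
Require Import Defs.
From HB Require Import structures.
From mathcomp Require Import all_boot all_order all_algebra.
From mathcomp Require Import all_classical all_reals all_analysis.
From mathcomp Require Import measurable_realfun ring lra.

Import Order.TTheory GRing.Theory Num.Theory.
Import numFieldNormedType.Exports.

Set Implicit Arguments.
Unset Strict Implicit.
Unset Printing Implicit Defensive.

Local Open Scope classical_set_scope.
Local Open Scope ring_scope.

(** * Measurability and affine changes of variables *)

(** Three obstacles shape the argument. Spheres carry the cone measure, so polar coordinates have to
    be derived; they come from Tonelli's theorem and dilations, hence for nonnegative functions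
    only. This is why coordinates are split into positive and negative parts before they are
    integrated over spheres. For alpha <= 0 the potential is a limit, and limits do not commute with
    derivatives for free. Finally, the norm is not differentiable at 0. The kernel is smoothed as a
    function of t = |z|^2, by its tangent line below a threshold; the first-order error is then
    quadratic in h, uniformly in y. For alpha > 1 the singular kernel itself is differentiated: in a
    small ball around the singularity the error is at most |h| times a weight of small integral, and
    outside it the bound for the smoothed kernel applies. *)

Section measurable_rV.
Context (R : realType) (m : nat).
Implicit Types (x h : 'rV[R]_m) (t : R).

Lemma measurable_rV_affine t h :
  measurable_fun [set: 'rV[R]_m] (fun x => t *: x + h).
Proof.
apply: measurable_fun_rVP => i.
rewrite (_ : _ \o _ = (fun x : 'rV[R]_m => t * rV_coord i x + h 0 i)).
  apply: measurable_funD => //; apply: measurable_funM => //.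
  exact: measurable_rV_coord.
by apply/funext => x; rewrite /rV_coord /= !mxE.
Qed.

Lemma measurable_rV_box (q : 'rV[R]_m) (e : R) :
  measurable [set x : 'rV[R]_m | forall i, `|q 0 i - x 0 i| < e].
Proof.
rewrite (_ : mkset _ = \bigcap_(i in [set: 'I_m])
    (@rV_coord R m i @^-1` ball (q 0 i) e)).
  apply: fin_bigcap_measurable => // i _.
  rewrite -[X in measurable X]setTI; apply: measurable_rV_coord => //.
  exact: measurable_ball.
by apply/seteqP; split=> x /= H i //; have := H i; rewrite /ball/=; exact.
Qed.

(** The sigma-algebra is generated by the coordinates, so countably many cylinder conditions must
    suffice: an open set is the union of the sup-norm boxes with rational centre and radius 1/(n+1)
    that it contains. *)
Lemma open_measurable_rV (U : set 'rV[R]_m) : open U -> measurable U.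
Proof.
move=> oU.
pose box (p : 'rV[rat]_m * nat) :=
  [set x : 'rV[R]_m | forall i,
    `|(map_mx ratr p.1 : 'rV[R]_m) 0 i - x 0 i| < p.2.+1%:R^-1].
have -> : U = \bigcup_(p in [set p | box p `<=` U]) box p.
  apply/seteqP; split=> [x Ux|x [p /= + bx]]; last exact.
  have /nbhs_ballP[e e0 eU] : nbhs x U by rewrite nbhsE; exists U.
  (* Half of [e], since two distances add up: from [x] to the rational centre, and from there to a
     point of the box. *)
  have [n ne] : exists n : nat, n.+1%:R^-1 < e / 2.
    have [n _ /(_ n)] := near_infty_natSinv_lt (PosNum (divr_gt0 e0 (@ltr0n R 2))).
    by move=> /(_ (leqnn n)) /= ?; exists n.
  have H i : exists q : rat, `|ratr q - x 0 i| < n.+1%:R^-1.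
    have /rat_in_itvoo[q] : x 0 i - n.+1%:R^-1 < x 0 i + n.+1%:R^-1 :> R.
      by rewrite ltrD2l gtrN.
    by rewrite in_itv/= => qx; exists q; rewrite ltr_distl.
  have [q Hq] := choice H.
  exists (\row_i q i, n) => /=; last by move=> i /=; rewrite !mxE.
  move=> y /= Hy; apply: eU; split => // i j; rewrite /ball/= ord1.
  have /= := Hy j; have := Hq j; rewrite !mxE => H1 H2.
  rewrite (le_lt_trans (ler_distD (ratr (q j)) _ _))//.
  by rewrite (distrC (x 0 j)) [e]splitr ltrD// (lt_trans _ ne).
rewrite bigcup_mkcond; apply: countable_bigcupT_measurable => [|p].
  exact: countableP.
case: ifPn => _; last exact: measurable0.
exact: measurable_rV_box.
Qed.

Lemma closed_measurable_rV (A : set 'rV[R]_m) : closed A -> measurable A.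
Proof.
move=> cA; rewrite -[A]setCK; apply: measurableC.
by apply: open_measurable_rV; exact: closed_openC.
Qed.

End measurable_rV.

Section lebesgue_affine.
Context (R : realType).
Local Open Scope ereal_scope.

Lemma ge0_integral_rV_cons m (f : 'rV[R]_m.+1 -> \bar R) :
  measurable_fun setT f -> (forall x, 0 <= f x) ->
  \int[lebesgue_rV R m.+1]_x f x =
  \int[@lebesgue_measure R]_a \int[lebesgue_rV R m]_y f (rV_cons (a, y)).
Proof.
move=> mf f0.
rewrite [LHS](@ge0_integral_pushforward _ _ _ _ R _ (@measurable_rV_cons R m)
   (@lebesgue_measure R \x lebesgue_rV R m) setT f)//.
rewrite preimage_setT (fubini_tonelli1 (f \o @rV_cons R m))//.
  by apply: measurableT_comp => //; exact: measurable_rV_cons.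
by move=> x; exact: f0.
Qed.

(** The left-hand side is a measure in [A] that agrees with Lebesgue measure on the intervals ]a,
    b]; uniqueness does the rest. *)
Lemma lebesgue_measure_affine (t h : R) (A : set (measurableTypeR R)) :
  (t != 0)%R -> measurable A ->
  (`|t|%:E * lebesgue_measure ((fun x => t * x + h)%R @^-1` A) = lebesgue_measure A).
Proof.
move=> t0 mA.
have mphi : measurable_fun [set: measurableTypeR R]
    (fun x => t * x + h : measurableTypeR R)%R.
  by apply: measurable_funD => //; exact: measurable_funM.
pose mu := mscale (NngNum (normr_ge0 t))
  (measure_function_pushforward__canonical__measure_function_Measure
     (@lebesgue_measure R) mphi).
rewrite -[LHS]/(mu A); apply/esym/lebesgue_measure_unique => // _ [[a b]] _ <-.
rewrite -[RHS]/(`|t|%:E * lebesgue_measure ((fun x => t * x + h)%R @^-1` `]a, b])).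
have [ab|ba] := ltP a b; last first.
  by rewrite set_itv_ge ?bnd_simp -?leNgt// preimage_set0 !measure0 mule0.
have pre : (fun x => t * x + h)%R @^-1` `]a, b] =
   if (0 < t)%R then `]((a - h) / t)%R, ((b - h) / t)%R]%classic
   else `[((b - h) / t)%R, ((a - h) / t)%R[%classic.
  apply/seteqP; split=> x /=; rewrite in_itv/= => H.
    case: ltgtP t0 => // t0 _ /=; rewrite in_itv/=.
      by rewrite ltr_pdivrMr// ler_pdivlMr//; move: H => /andP[]; lra.
    by rewrite ltr_ndivlMr// ler_ndivrMr//; move: H => /andP[]; lra.
  case: ltgtP t0 H => // t0 _ /=; rewrite in_itv/=.
    by rewrite ltr_pdivrMr// ler_pdivlMr//= => /andP[]; lra.
  by rewrite ltr_ndivlMr// ler_ndivrMr//= => /andP[]; lra.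
rewrite pre lebesgue_measure_itv/= lte_fin ab.
case: ltgtP t0 => // t0 _.
  rewrite lebesgue_measure_itv/= lte_fin ltr_pM2r ?invr_gt0// ltrD2r ab.
  by rewrite gtr0_norm// -EFinD -EFinM; congr EFin; field; rewrite gt_eqF.
rewrite lebesgue_measure_itv/= lte_fin ltr_nM2r ?invr_lt0// ltrD2r ab.
by rewrite ltr0_norm// -EFinD -EFinM; congr EFin; field; rewrite lt_eqF.
Qed.

Lemma ge0_integral_affine (t h : R) (f : R -> \bar R) :
  (t != 0)%R -> measurable_fun setT f -> (forall x, 0 <= f x) ->
  \int[@lebesgue_measure R]_x f (t * x + h)%R =
  (`|t|^-1)%:E * \int[@lebesgue_measure R]_x f x.
Proof.
move=> t0 mf f0.
have mphi : measurable_fun [set: measurableTypeR R]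
    (fun x => t * x + h : measurableTypeR R)%R.
  by apply: measurable_funD => //; exact: measurable_funM.
transitivity (\int[pushforward (@lebesgue_measure R)
    (fun x : R => t * x + h : measurableTypeR R)%R]_x f x).
  by rewrite ge0_integral_pushforward// preimage_setT.
have it0 : (0 <= `|t|^-1)%R by rewrite invr_ge0.
rewrite (@eq_measure_integral _ _ _ _ (mscale (NngNum it0) (@lebesgue_measure R))).
  by rewrite ge0_integral_mscale.
move=> A mA _ /=; rewrite /mscale/= -(@lebesgue_measure_affine t h)//.
by rewrite muleA -EFinM mulVf ?normr_eq0// mul1e.
Qed.

(** Induction on m by Tonelli: the map acts separately on the first coordinate and on the others,
    and each coordinate contributes a factor |t|^-1. *)
Lemma ge0_integral_rV_affine m (t : R) (h : 'rV[R]_m) (f : 'rV[R]_m -> \bar R) :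
  (t != 0)%R -> measurable_fun setT f -> (forall x, 0 <= f x) ->
  \int[lebesgue_rV R m]_x f (t *: x + h)%R =
  (`|t| ^- m)%:E * \int[lebesgue_rV R m]_x f x.
Proof.
move=> t0; elim: m h f => [|m ih] h f mf f0.
  rewrite expr0 invr1 mul1e; apply: eq_integral => x _.
  by congr f; rewrite (thinmx0 x) (thinmx0 h) scaler0 addr0.
rewrite ge0_integral_rV_cons//; last first.
  by apply: (measurableT_comp mf); exact: measurable_rV_affine.
pose h' := rsubmx (h : 'rV[R]_(1 + m)).
have consE a y : (t *: rV_cons (a, y) + h = rV_cons (t * a + h 0 0, t *: y + h'))%R.
  apply/rowP => i; case: (split_ordP (i : 'I_(1 + m))) => j ->.
    rewrite ord1 [LHS]mxE [X in (X + _)%R]mxE !rV_consEl/=.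
    by congr (_ + h _ _)%R; exact/val_inj.
  by rewrite [LHS]mxE [X in (X + _)%R]mxE !rV_consEr/= !mxE.
have mfc : measurable_fun setT (f \o @rV_cons R m).
  by apply: measurableT_comp => //; exact: measurable_rV_cons.
pose F a := \int[lebesgue_rV R m]_y f (rV_cons (a, y)).
have mF : measurable_fun [set: measurableTypeR R] F.
  by apply: (measurable_fun_fubini_tonelli_F (f \o @rV_cons R m)) => // x; exact: f0.
have F0 a : 0 <= F a by apply: integral_ge0.
have stepE a : \int[lebesgue_rV R m]_y f (t *: rV_cons (a, y) + h)%R =
    (`|t| ^- m)%:E * F (t * a + h 0 0)%R.
  under eq_integral do rewrite consE.
  rewrite (ih h' (fun y => f (rV_cons ((t * a + h 0 0)%R, y))))//.
  exact: (measurableT_comp mfc (measurable_pair1 _)).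
under eq_integral do rewrite stepE.
rewrite ge0_integralZl//.
- rewrite (ge0_integral_affine _ t0 mF F0) muleA -EFinM ge0_integral_rV_cons//.
  by rewrite exprSr invfM.
- apply: (measurableT_comp mF); apply: measurable_funD => //.
Qed.

End lebesgue_affine.

(** * The Euclidean norm *)

Section enorm_theory.
Context (R : realType) (m : nat).
Implicit Types x y : 'rV[R]_m.

Lemma enorm_ge0 x : 0 <= enorm x.
Proof. exact: sqrtr_ge0. Qed.

Lemma sqr_enorm x : enorm x ^+ 2 = \sum_(i < m) x 0 i ^+ 2.
Proof. by rewrite sqr_sqrtr// sumr_ge0// => i _; rewrite sqr_ge0. Qed.

Lemma enorm_eq0 x : (enorm x == 0) = (x == 0).
Proof.
rewrite -sqrf_eq0 sqr_enorm; apply/idP/idP => [|/eqP->]; last first.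
  by rewrite big1// => i _; rewrite mxE expr0n.
rewrite psumr_eq0 => [/allP H|i _]; last exact: sqr_ge0.
apply/eqP/rowP => i; rewrite mxE.
by have := H i (mem_index_enum _); rewrite sqrf_eq0 => /eqP.
Qed.

Lemma enorm0 : enorm (0 : 'rV[R]_m) = 0.
Proof. by apply/eqP; rewrite enorm_eq0. Qed.

Lemma enorm_gt0 x : (0 < enorm x) = (x != 0).
Proof. by rewrite lt0r enorm_ge0 andbT enorm_eq0. Qed.

Lemma enormZ (t : R) x : enorm (t *: x) = `|t| * enorm x.
Proof.
apply: (@pexpIrn _ 2) => //; rewrite ?nnegrE ?mulr_ge0 ?enorm_ge0//.
rewrite exprMn !sqr_enorm real_normK ?num_real// mulr_sumr.
by apply: eq_bigr => i _; rewrite mxE exprMn.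
Qed.

Lemma enormN x : enorm (- x) = enorm x.
Proof. by rewrite -scaleN1r enormZ normrN1 mul1r. Qed.

Lemma enormBC x y : enorm (x - y) = enorm (y - x).
Proof. by rewrite -enormN opprB. Qed.

Definition dotv x y : R := \sum_(i < m) x 0 i * y 0 i.

Lemma enormD_sqr x y :
  enorm (x + y) ^+ 2 = enorm x ^+ 2 + 2 * dotv x y + enorm y ^+ 2.
Proof.
rewrite !sqr_enorm /dotv mulr_sumr -!big_split/=.
by apply: eq_bigr => i _; rewrite !mxE; ring.
Qed.

(** Cauchy-Schwarz: |x + t y|^2 is nonnegative at its minimum in t. *)
Lemma dotv_le x y : `|dotv x y| <= enorm x * enorm y.
Proof.
have [->|y0] := eqVneq y 0.
  rewrite enorm0 mulr0 /dotv big1 ?normr0// => i _.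
  by rewrite mxE mulr0.
have Y0 : 0 < enorm y ^+ 2 by rewrite exprn_gt0// enorm_gt0.
rewrite -(ler_pXn2r (n := 2)) ?nnegrE ?mulr_ge0 ?enorm_ge0// exprMn.
rewrite real_normK ?num_real//.
pose t := - (dotv x y / enorm y ^+ 2).
have : 0 <= enorm (x + t *: y) ^+ 2 by rewrite sqr_ge0.
rewrite enormD_sqr enormZ exprMn real_normK ?num_real//.
have -> : dotv x (t *: y) = t * dotv x y.
  by rewrite /dotv mulr_sumr; apply: eq_bigr => i _; rewrite mxE; ring.
have -> : enorm x ^+ 2 + 2 * (t * dotv x y) + t ^+ 2 * enorm y ^+ 2 =
    (enorm x ^+ 2 * enorm y ^+ 2 - dotv x y ^+ 2) / enorm y ^+ 2.
  by rewrite /t; field; rewrite enorm_eq0.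
by rewrite pmulr_lge0 ?invr_gt0// subr_ge0.
Qed.

Lemma enormD x y : enorm (x + y) <= enorm x + enorm y.
Proof.
rewrite -(ler_pXn2r (n := 2)) ?nnegrE ?addr_ge0 ?enorm_ge0// enormD_sqr.
have := le_trans (ler_norm _) (dotv_le x y); rewrite sqrrD; lra.
Qed.

Lemma enorm_dist x y : `|enorm x - enorm y| <= enorm (x - y).
Proof.
have := enormD (x - y) y; have := enormD (y - x) x.
by rewrite !subrK [enorm (y - x)]enormBC ler_norml; lra.
Qed.

Lemma coord_le_enorm x i : `|x 0 i| <= enorm x.
Proof.
rewrite -(ler_pXn2r (n := 2)) ?nnegrE ?enorm_ge0// sqr_enorm.
rewrite real_normK ?num_real// (bigD1 i)//= lerDl.
by apply: sumr_ge0 => j _; exact: sqr_ge0.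
Qed.

Lemma norm_le_enorm x : `|x| <= enorm x.
Proof.
rewrite /Num.norm/= mx_normrE; apply/bigmax_leP; split; first exact: enorm_ge0.
by move=> [i j] _ /=; rewrite ord1; exact: coord_le_enorm.
Qed.

Lemma enorm_le_norm x : enorm x <= m%:R * `|x|.
Proof.
rewrite -(ler_pXn2r (n := 2)) ?nnegrE ?mulr_ge0 ?enorm_ge0//.
rewrite sqr_enorm exprMn (@le_trans _ _ (m%:R * `|x| ^+ 2))//; last first.
  rewrite ler_wpM2r ?exprn_ge0// -natrX ler_nat.
  by case: (m) => // k; rewrite -mulnn leq_pmulr.
apply: (@le_trans _ _ (\sum_(i < m) `|x| ^+ 2)); last first.
  by rewrite sumr_const card_ord mulr_natl.
apply: ler_sum => i _; rewrite -real_normK ?num_real//.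
rewrite ler_pXn2r ?nnegrE//.
rewrite [leRHS]/Num.norm/= mx_normrE.
exact: (le_bigmax _ (fun ij => `|x ij.1 ij.2|) (0, i)).
Qed.

Lemma nbhs0_enorm (P : set 'rV[R]_m) :
  (exists2 e, 0 < e & forall x, enorm x < e -> P x) <-> (\forall x \near (0 : 'rV[R]_m), P x).
Proof.
split=> [[e e0 H]|/nbhs_norm0P[e /= e0 H]].
  apply/nbhs_norm0P; exists (e / m.+1%:R) => /=; first exact: divr_gt0.
  move=> x /=; rewrite ltr_pdivlMr// => xe; apply: H.
  rewrite (le_lt_trans (enorm_le_norm x))// (le_lt_trans _ xe)// mulrC.
  by rewrite ler_wpM2l// ler_nat.
by exists e => // x xe; apply: H => /=; rewrite (le_lt_trans (norm_le_enorm x)).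
Qed.
End enorm_theory.

(** * Polar coordinates *)

(** Supplies the normalisation of the polar formula. The primitive -r^(-(m+1)) vanishes at
    infinity. *)
Lemma integral_expNS (R : realType) (m : nat) (a : R) : (0 < a)%R ->
  (\int[@lebesgue_measure R]_(r in `[a, +oo[) ((m.+1)%:R * r^-1 ^+ m.+2)%:E =
   (a^-1 ^+ m.+1)%:E)%E.
Proof.
move=> a0.
have dF (x : R) : 0 < x -> is_derive x 1 (fun r : R => - (r^-1 ^+ m.+1))
     (m.+1%:R * x^-1 ^+ m.+2).
  move=> x0; have x1 : x != 0 by rewrite gt_eqF.
  have /(@is_deriveX _ _ _ m.+1) dV := @is_deriveV R id x 1 1 x1 (is_derive_id _ _).
  rewrite (_ : (fun _ => _) = - ((fun r : R => r^-1) ^+ m.+1)); last first.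
    by apply/funext => r; rewrite !fctE.
  apply: is_derive_eq.
  by rewrite -exprVn /GRing.scale/= !exprS; ring.
rewrite (@ge0_continuous_FTC2y _ _ (fun r => - (r^-1 ^+ m.+1)) a 0).
- by rewrite sub0e EFinN oppeK.
- by move=> x ax; rewrite mulr_ge0// exprn_ge0// invr_ge0 (le_trans (ltW a0)).
- apply: continuous_in_subspaceT => x /[!inE]/= /[!in_itv]/= /andP[ax _].
  have x0 : x != 0 by rewrite gt_eqF// (lt_le_trans a0).
  apply: cvgM; first exact: cvg_cst.
  have := @exprn_continuous R m.+2 x^-1.
  by move=> /(continuous_comp (inv_continuous x0)); exact.
- rewrite -oppr0; apply: cvgN.
  rewrite [X in _ --> X](_ : 0 = 0 ^+ m.+1 :> R); last by rewrite expr0n.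
  apply: (@cvg_comp _ _ _ (fun r : R => r^-1) (fun r : R => r ^+ m.+1)); last exact: exprn_continuous.
  apply/cvgr0Pnorm_lt => e e0; near=> r.
  have r0 : 0 < r by [].
  rewrite ger0_norm ?invr_ge0 ?ltW// invf_plt//; near: r.
  by apply: nbhs_pinfty_gt; rewrite num_real.
- by move=> x ax; have [] := dF x (lt_trans a0 ax).
- apply: cvg_at_right_filter.
  have [/derivable1_diffP/differentiable_continuous + _] := dF a a0.
  exact.
- move=> x; rewrite in_itv/= andbT => ax; rewrite derive1E.
  by have [_] := dF x (lt_trans a0 ax).
Unshelve. all: by end_near.
Qed.

Lemma integral_expN (R : realType) (m : nat) (a : R) : (0 < m)%N -> (0 < a)%R ->
  (\int[@lebesgue_measure R]_(r in `[a, +oo[) (m%:R * r^-1 ^+ m.+1)%:E =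
   (a^-1 ^+ m)%:E)%E.
Proof. by case: m => // m _; exact: integral_expNS. Qed.

Section lebesgue_polar.
Context (R : realType) (m : nat).
Notation mu := (@lebesgue_measure R).
Notation lam := (lebesgue_rV R m).
Local Open Scope ereal_scope.

(** Serves to bound the measure of bounded sets; a cube, unlike a ball, is a product. *)
Lemma lebesgue_rV_cube (c : R) : (0 <= c)%R ->
  lam [set x : 'rV[R]_m | forall i, (`|x 0 i| <= c)%R] = ((2 * c) ^+ m)%:E.
Proof.
move=> c0; elim: (m) => [|n ih].
  rewrite expr0 /= diracE mem_set//= => -[]//.
transitivity ((mu \x lebesgue_rV R n) ([set` `[(- c)%R, c]] `*`
    [set x : 'rV[R]_n | forall i, (`|x 0 i| <= c)%R])).
  rewrite -[LHS]/((mu \x lebesgue_rV R n) _); congr ((_ \x _) _).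
  apply/seteqP; split=> [[a y] /= H|[a y] /= [+ H] i].
  - split; last by move=> i; have := H (rshift 1 i : 'I_(1 + n)); rewrite rV_consEr.
    by rewrite in_itv/= -ler_norml; have := H (lshift n 0%R : 'I_(1 + n)); rewrite rV_consEl.
  - rewrite in_itv/= -ler_norml => ac.
    case: (split_ordP (i : 'I_(1 + n))) => j ->; last by rewrite rV_consEr.
    by rewrite ord1 rV_consEl.
rewrite product_measure1E//.
  rewrite ih exprS EFinM; congr (_ * _).
  rewrite -[LHS]/(mu `[(- c)%R, c]) lebesgue_measure_itv/= lte_fin.
  case: ltP => [_|]; first by rewrite -EFinD; congr EFin; ring.
  by rewrite -subr_le0 opprK => cc; congr EFin; lra.
rewrite (_ : mkset _ = \bigcap_(i in [set: 'I_n]) (@rV_coord R n i @^-1` `[(- c)%R, c])).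
  apply: fin_bigcap_measurable => // i _.
  by rewrite -[X in measurable X]setTI; apply: measurable_rV_coord.
by apply/seteqP; split=> x /= H i => [_|]; have := H i; rewrite /rV_coord/= in_itv/= -ler_norml//; exact.
Qed.

(** A point lies in a hyperplane {x_0} x R^n, whose measure is a product with first factor 0. In R^0
    the point would have mass 1. *)
Lemma lebesgue_rV_set1 (x : 'rV[R]_m) : (0 < m)%N -> lam [set x] = 0.
Proof.
case: (m) x => // n x _; rewrite -[LHS]/((mu \x lebesgue_rV R n) _).
have mx : measurable (@rV_cons R n @^-1` [set x]).
  rewrite -[X in measurable X]setTI; apply: measurable_rV_cons => //.
  apply: closed_measurable_rV; apply: accessible_closed_set1.
  by apply: hausdorff_accessible; exact: norm_hausdorff.
apply/eqP; rewrite eq_le measure_ge0 andbT.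
rewrite (@le_trans _ _ ((mu \x lebesgue_rV R n) ([set x 0%R 0%R] `*` setT)))//.
  apply: le_measure; rewrite ?inE//; first exact: measurableX.
  move=> [a y] /= <-; split => //=; rewrite -[LHS](rV_consEl (a, y)).
  by congr (rV_cons _ _ _); exact/val_inj.
rewrite product_measure1E//.
by rewrite [X in X * _](lebesgue_measure_set1 (x 0%R 0%R)) mul0e.
Qed.

Definition pos : set R := `]0%R, +oo[%classic.

Lemma measurable_pos : measurable pos.
Proof. exact: measurable_itv. Qed.
#[local] Hint Resolve measurable_pos : core.

Lemma measurable_radial2 :
  measurable_fun [set: measurableTypeR R * 'rV[R]_m] (fun p => radial p.1 p.2).
Proof.
apply: measurable_fun_rVP => i.
(* The reciprocal of the norm is written as the power -1, a measurable function; at norm 0 both are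
   0. *)
rewrite (_ : _ \o _ = (fun p : measurableTypeR R * 'rV[R]_m =>
    p.1 * enorm p.2 `^ (-1) * p.2 0 i)%R); last first.
  by apply/funext => p; rewrite /rV_coord /= mxE powR_inv1// sqrtr_ge0.
apply: measurable_funM; last first.
  by apply: (@measurableT_comp _ _ _ _ _ _ (@rV_coord R m i)) => //; exact: measurable_rV_coord.
apply: measurable_funM => //.
apply: (@measurableT_comp _ _ _ _ _ _ (@powR R ^~ (-1)%R)) => //.
by apply: (measurableT_comp (@measurable_enorm R m)).
Qed.

Lemma measurable_scale2 :
  measurable_fun [set: measurableTypeR R * 'rV[R]_m] (fun p => p.1 *: p.2 : 'rV[R]_m)%R.
Proof.
apply: measurable_fun_rVP => i.
rewrite (_ : _ \o _ = (fun p : measurableTypeR R * 'rV[R]_m =>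
    p.1 * p.2 0 i)%R); last first.
  by apply/funext => p; rewrite /rV_coord /= mxE.
apply: measurable_funM => //.
by apply: (@measurableT_comp _ _ _ _ _ _ (@rV_coord R m i)) => //; exact: measurable_rV_coord.
Qed.

Lemma measurable_invr : measurable_fun [set: R] (fun r : R => \1_pos r * r^-1)%R.
Proof.
rewrite (_ : (fun _ => _) = (fun r : R => \1_pos r * r `^ (-1))%R).
  apply: measurable_funM; first exact: measurable_indic.
  exact: measurable_powR.
apply/funext => r; rewrite indicE; case: (boolP (r \in pos)) => [|_]; last by rewrite !mul0r.
by rewrite inE /pos/= in_itv/= andbT => r0; rewrite powR_inv1// ltW.
Qed.

Local Notation B := (@punctured_eball R m).

(* Fubini for the substitutions [r := |u| r] and [x := r u]; what is left is the
   factor m |x|^m \int_(|x|)^oo r^(-m-1) dr = 1. *)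
Lemma ge0_integral_polar_aux (F : 'rV[R]_m -> \bar R) : (0 < m)%N ->
  measurable_fun setT F -> (forall x, 0 <= F x) -> F 0%R = 0 ->
  \int[lam]_x F x = \int[mu]_r \int[lam]_u
    ((\1_pos r * \1_B u * (m%:R * r ^+ m.-1))%:E * F (radial r u)).
Proof.
move=> m0 mF F0 F00.
have exm (x : R) : (x ^+ m = x * x ^+ m.-1)%R by rewrite -exprS prednK.
pose pi1 : measurableTypeR R * 'rV[R]_m -> measurableTypeR R := fst.
pose pi2 : measurableTypeR R * 'rV[R]_m -> 'rV[R]_m := snd.
have m1 : measurable_fun setT pi1 by exact: measurable_fst.
have m2 : measurable_fun setT pi2 by exact: measurable_snd.
have mpos : measurable_fun setT (fun p => \1_pos (pi1 p) : R).
  by apply: (measurableT_comp (measurable_indic _) m1).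
have mB : measurable_fun setT (fun p => \1_B (pi2 p) : R).
  apply: (measurableT_comp (measurable_indic _) m2); exact: measurable_punctured_eball.
have men : measurable_fun setT (fun p => enorm (pi2 p) : R).
  by apply: (measurableT_comp (@measurable_enorm R m)).
pose G (p : measurableTypeR R * 'rV[R]_m) :=
  (\1_pos p.1 * \1_B p.2 * (m%:R * p.1 ^+ m.-1))%:E * F (radial p.1 p.2).
have pos0 (r : R) : (0 <= \1_pos r :> R)%R by rewrite indicE.
have B0 u : (0 <= \1_B u :> R)%R by rewrite indicE.
have G0 p : 0 <= G p.
  rewrite /G indicE; have [|_] := boolP (p.1 \in pos); last by rewrite !mul0r mul0e.
  rewrite inE /pos/= in_itv/= andbT => p0.
  by rewrite mule_ge0// lee_fin !mulr_ge0// exprn_ge0// ltW.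
have mG : measurable_fun setT G.
  apply: emeasurable_funM; last exact: (measurableT_comp mF measurable_radial2).
  apply/measurable_EFinP; do 2 apply: measurable_funM => //.
  exact: measurable_funX.
(* [G] after r := |u| r. The projection becomes a multiplication by r, so that the next substitution
   is a dilation. *)
pose H (p : measurableTypeR R * 'rV[R]_m) :=
  (\1_pos p.1 * \1_B p.2 * (m%:R * enorm p.2 ^+ m * p.1 ^+ m.-1))%:E * F (p.1 *: p.2)%R.
have H0 p : 0 <= H p.
  rewrite /H indicE; have [|_] := boolP (p.1 \in pos); last by rewrite !mul0r mul0e.
  rewrite inE /pos/= in_itv/= andbT => p0.
  by rewrite mule_ge0// lee_fin !mulr_ge0 ?exprn_ge0 ?enorm_ge0// ltW.
have mH : measurable_fun setT H.
  apply: emeasurable_funM; last exact: (measurableT_comp mF measurable_scale2).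
  apply/measurable_EFinP; do 2 apply: measurable_funM => //.
    by apply: measurable_funM => //; exact: measurable_funX.
  exact: measurable_funX.
(* [H] after x := r u. Cutting off the inverse keeps [K] nonnegative and measurable on the whole
   product; for r <= 0 the power m+1 makes it vanish. *)
pose K (p : measurableTypeR R * 'rV[R]_m) :=
  (\1_B ((\1_pos p.1 * p.1^-1) *: p.2)%R * (m%:R * (enorm p.2 ^+ m) * (\1_pos p.1 * p.1^-1) ^+ m.+1))%:E
   * F p.2.
have minv : measurable_fun setT (fun p => \1_pos (pi1 p) * (pi1 p)^-1 : R)%R.
  exact: (measurableT_comp measurable_invr m1).
have K0 p : 0 <= K p.
  rewrite /K mule_ge0// lee_fin !mulr_ge0 ?exprn_ge0 ?enorm_ge0//.
  rewrite indicE; have [|_] := boolP (p.1 \in pos); last by rewrite mul0r.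
  by rewrite inE /pos/= in_itv/= andbT mul1r invr_ge0 => /ltW.
have mK : measurable_fun setT K.
  apply: emeasurable_funM; last exact: (measurableT_comp mF m2).
  apply/measurable_EFinP; apply: measurable_funM => //.
    apply: (@measurableT_comp _ _ _ _ _ _ (\1_B : 'rV[R]_m -> R)).
      by apply: measurable_indic; exact: measurable_punctured_eball.
    apply: (@measurableT_comp _ _ _ _ _ _ (fun p : measurableTypeR R * 'rV[R]_m =>
       p.1 *: p.2 : 'rV[R]_m)%R _ (fun p => (\1_pos (pi1 p) * (pi1 p)^-1 : measurableTypeR R, pi2 p)%R)).
      exact: measurable_scale2.
    exact/measurable_fun_pairP.
  apply: measurable_funM; last exact: measurable_funX.
  by apply: measurable_funM => //; exact: measurable_funX.
have GH u : \int[mu]_r G (r, u) = \int[mu]_r H (r, u).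
  have [uB|uB] := boolP (u \in B); last first.
    by apply: eq_integral => r _; rewrite /G /H/= !indicE (negbTE uB) !(mulr0, mul0r) !mul0e.
  have u0 : (0 < enorm u)%R by move: uB; rewrite inE /punctured_eball/= => /andP[].
  have HG r : H (r, u) = (enorm u)%:E * G (enorm u * r + 0, u)%R.
    have rE : (enorm u * r / enorm u)%R = r by rewrite mulrAC divff ?mul1r ?gt_eqF.
    rewrite /H /G /= /radial addr0 rE muleA -EFinM.
    have -> : \1_pos (enorm u * r)%R = \1_pos r :> R.
      by rewrite !indicE; congr (_%:R); congr nat_of_bool; apply/idP/idP;
        rewrite !inE /pos/= !in_itv/= !andbT pmulr_rgt0.
    by congr (_%:E * _); rewrite exprMn exm; ring.
  under [RHS]eq_integral do rewrite HG.
  have mGu : measurable_fun setT (fun r => G (r, u)).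
    exact: (measurableT_comp mG (measurable_pair2 u)).
  rewrite ge0_integralZl//.
  - rewrite (@ge0_integral_affine _ _ _ (fun r => G (r, u))) ?gt_eqF//.
    by rewrite gtr0_norm// muleA -EFinM divff ?gt_eqF// mul1e.
  - by apply: (measurableT_comp mGu); apply: measurable_funD => //; exact: measurable_funM.
  - by rewrite lee_fin ltW.
have HK r : \int[lam]_u H (r, u) = \int[lam]_x K (r, x).
  have [r0|r0] := boolP (r \in pos); last first.
    by apply: eq_integral => u _; rewrite /H /K/= [X in X%:E]mulrC ![\1_pos r]indicE (negbTE r0) !mul0r expr0n !mulr0 !mul0e.
  have pr : \1_pos r = 1%R :> R by rewrite indicE r0.
  move: r0; rewrite inE /pos/= in_itv/= andbT => r0.
  have HKu u : H (r, u) = (r ^+ m)%:E * K (r, r *: u + 0)%R.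
    rewrite /H /K /= pr !mul1r addr0 scalerA mulVf ?gt_eqF// scale1r muleA -EFinM.
    congr (_%:E * _); rewrite enormZ gtr0_norm// exprMn exprS.
    have E1 : (r ^+ m * r^-1 ^+ m = 1)%R by rewrite -exprMn divff ?expr1n// gt_eqF.
    have E2 : (r ^+ m * r^-1 = r ^+ m.-1)%R.
      by rewrite exm mulrAC divff ?mul1r// gt_eqF.
    transitivity (\1_B u * (m%:R * enorm u ^+ m) *
       ((r ^+ m * r^-1 ^+ m) * (r ^+ m * r^-1)))%R; last by ring.
    by rewrite E1 E2; ring.
  under eq_integral do rewrite HKu.
  have mKr : measurable_fun setT (fun x => K (r, x)).
    exact: (measurableT_comp mK (measurable_pair1 r)).
  rewrite ge0_integralZl//.
  - rewrite (@ge0_integral_rV_affine _ _ _ _ (fun u => K (r, u))) ?gt_eqF//.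
    by rewrite gtr0_norm// muleA -EFinM divff ?gt_eqF ?exprn_gt0// mul1e.
  - by apply: (measurableT_comp mKr); exact: measurable_rV_affine.
  - by rewrite lee_fin exprn_ge0// ltW.
have KF x : \int[mu]_r K (r, x) = F x.
  (* The points r u with u in the punctured ball and r > 0 never reach the origin, hence the
     assumption [F 0 = 0]. *)
  have [->|x0] := eqVneq x 0%R.
    by rewrite F00 integral0_eq// => r _; rewrite /K/= F00 mule0.
  have s0 : (0 < enorm x)%R by rewrite enorm_gt0.
  have KE r : K (r, x) = (enorm x ^+ m)%:E * F x *
     ((fun r => (m%:R * r^-1 ^+ m.+1)%:E) \_ `[enorm x, +oo[) r.
    rewrite /K/= patchE; case: ifPn => [|]; rewrite ?notin_setE ?inE/= in_itv/= andbT.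
      move=> xr; have r0 : (0 < r)%R := lt_le_trans s0 xr.
      have -> : \1_pos r = 1%R :> R by rewrite indicE mem_set//= /pos/= in_itv/= andbT.
      rewrite indicE mem_set//=; last first.
        rewrite /punctured_eball/= mul1r enormZ gtr0_norm ?invr_gt0//.
        by rewrite mulr_gt0 ?invr_gt0//= ler_pdivrMl// mulr1.
      rewrite !mul1r mulrAC mulrC !EFinM -!muleA; congr (_ * _).
      by rewrite -EFinM [in RHS]muleC EFinM muleA.
    move/negP; rewrite -ltNge => rx; rewrite [point](_ : _ = 0)// mule0.
    have [r0|r0] := leP r 0%R.
      by rewrite ![\1_pos r]indicE memNset/= ?mul0r ?expr0n ?mulr0 ?mul0e// /pos/= in_itv/= andbT ltNge r0.
    rewrite [\1_B _]indicE memNset/= ?mul0r ?mul0e// indicE mem_set/= ?mul1r; last first.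
      by rewrite /pos/= in_itv/= andbT.
    rewrite /punctured_eball/= enormZ gtr0_norm ?invr_gt0//.
    by rewrite mulr_gt0 ?invr_gt0//= ler_pdivrMl// mulr1 leNgt rx.
  have mk : measurable_fun [set: measurableTypeR R]
      ((fun r => (m%:R * r^-1 ^+ m.+1)%:E) \_ `[enorm x, +oo[).
    apply: (measurable_restrictT _ _).1 => //.
    apply: (eq_measurable_fun (fun r => (m%:R * (\1_pos r * r^-1) ^+ m.+1)%:E)).
      move=> r; rewrite inE/= in_itv/= andbT => xr.
      by rewrite indicE mem_set/= ?mul1r// /pos/= in_itv/= andbT (lt_le_trans s0).
    apply/measurable_EFinP; apply: measurable_funM => //.
    apply: measurable_funX; apply: measurable_funS measurable_invr => //.
  under eq_integral do rewrite KE.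
  rewrite ge0_integralZl//.
  - rewrite -integral_mkcond integral_expN// muleAC -EFinM -exprMn divff ?gt_eqF//.
    by rewrite expr1n mul1e.
  - move=> r _; apply: erestrict_ge0 => // t; rewrite /= in_itv/= andbT => xt.
    by rewrite lee_fin mulr_ge0// exprn_ge0// invr_ge0 (le_trans _ xt)// ltW.
  - by rewrite mule_ge0// lee_fin exprn_ge0// ltW.
(* [GH] substitutes in r, [HK] in u, and [KF] integrates in r again; each needs its variable to be
   the inner one, so Tonelli is used three times. *)
rewrite -[RHS](fubini_tonelli1 G)// [RHS]fubini_tonelli2//.
rewrite /fubini_G; under [RHS]eq_integral do rewrite GH.
rewrite -[RHS](fubini_tonelli2 H)// [RHS]fubini_tonelli1//.
rewrite /fubini_F; under [RHS]eq_integral do rewrite HK.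
rewrite -[RHS](fubini_tonelli1 K)// [RHS]fubini_tonelli2//.
by rewrite /fubini_G; under [RHS]eq_integral do rewrite KF.
Qed.

End lebesgue_polar.

(** * Integration over spheres *)

Section surface_integral.
Context (R : realType) (m : nat).
Notation mu := (@lebesgue_measure R).
Notation lam := (lebesgue_rV R m).
Notation B := (@punctured_eball R m).
Notation sigma := (@surface_measure R m).
Local Open Scope ereal_scope.
Implicit Types (F : 'rV[R]_m -> \bar R) (r : R).

(** What unfolding [surface_measure] leaves to integrate over u. It takes pairs so that joint
    measurability in (r, u) can be stated, as Tonelli requires. *)
Definition polar_integrand F (p : measurableTypeR R * 'rV[R]_m) : \bar R :=
  (\1_(@pos R) p.1 * \1_B p.2 * (m%:R * p.1 ^+ m.-1))%:E * F (radial p.1 p.2).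

Lemma measurable_polar_integrand F : measurable_fun setT F ->
  measurable_fun setT (polar_integrand F).
Proof.
move=> mF.
apply: emeasurable_funM; last exact: (measurableT_comp mF (@measurable_radial2 R m)).
apply/measurable_EFinP; apply: measurable_funM; first apply: measurable_funM.
- apply: (@measurableT_comp _ _ _ _ _ _ (\1_(@pos R) : R -> R)) => //.
  by apply: measurable_indic; exact: measurable_pos.
- apply: (@measurableT_comp _ _ _ _ _ _ (\1_B : 'rV[R]_m -> R)) => //.
  by apply: measurable_indic; exact: measurable_punctured_eball.
- by apply: measurable_funM => //; exact: measurable_funX.
Qed.

Lemma polar_integrand_ge0 F p : (forall x, 0 <= F x) -> 0 <= polar_integrand F p.
Proof.
move=> F0.
rewrite /polar_integrand indicE; have [|_] := boolP (p.1 \in @pos R); last by rewrite !mul0r mul0e.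
rewrite inE /pos/= in_itv/= andbT => p0.
by rewrite mule_ge0// lee_fin !mulr_ge0// ?exprn_ge0 ?indicE// ltW.
Qed.

Lemma radial_esphere r u : (0 < r)%R -> B u -> enorm (radial r u) = r.
Proof.
move=> r0 /andP[u0 _]; rewrite /radial enormZ ger0_norm ?divr_ge0 ?enorm_ge0 ?ltW//.
by rewrite mulfVK// gt_eqF.
Qed.

Lemma ge0_integral_surface r F (A : set 'rV[R]_m) : (0 < r)%R -> measurable A ->
  measurable_fun setT F -> (forall x, 0 <= F x) ->
  \int[sigma r]_(v in A) F v = \int[lam]_u polar_integrand (F \_ A) (r, u).
Proof.
move=> r0 mA mF F0.
have mB := @measurable_punctured_eball R m.
have mFA : measurable_fun setT (F \_ A).
  by apply: (measurable_restrictT _ _).1 => //; exact: measurable_funTS.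
have FA0 x : 0 <= (F \_ A) x by apply: erestrict_ge0.
have mFr : measurable_fun setT (F \_ A \o radial r).
  exact: (measurableT_comp mFA (measurable_radial r)).
rewrite integral_mkcond.
rewrite [LHS](@ge0_integral_pushforward _ _ _ _ R _ (@measurable_radial R m r)
  (mscale ((m%:R * `|r| ^+ m.-1)%:nng)%R (mrestr lam mB)) setT)//.
rewrite preimage_setT ge0_integral_mscale//.
(* The restricted measure does not charge the complement of the punctured ball, and on subsets of
   the ball it is [lam]. *)
have -> : \int[mrestr lam mB]_x (F \_ A \o radial r) x =
    \int[lam]_(x in B) (F \_ A \o radial r) x.
  have mBC : measurable (~` B) by exact: measurableC.
  rewrite -(setvU B) ge0_integral_setU//; last 3 first.
  - by rewrite setvU.
  - by move=> x _; exact: FA0.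
  - by apply/disj_setPS; rewrite setICl.
  rewrite null_set_integral ?add0e//; first last.
  - by rewrite -[LHS]/(lam (~` B `&` B)) setICl measure0.
  - exact: measurable_funTS.
  apply: eq_measure_integral => C mC CB; rewrite /mrestr/=.
  by rewrite -[LHS]/(lam (C `&` B)) setIidl.
rewrite integral_mkcond/= -ge0_integralZl//; last 2 first.
- by apply: (measurable_restrictT _ _).1 => //; exact: measurable_funTS.
- by move=> u _; apply: erestrict_ge0 => x _; exact: FA0.
apply: eq_integral => u _; rewrite /polar_integrand/= !patchE !indicE.
rewrite [r \in _]mem_set/= ?mul1r; last by rewrite /pos/= in_itv/= andbT.
rewrite ger0_norm ?(ltW r0)//.
case: ifPn => uB; first by rewrite mul1r.
  by rewrite mul0r mul0e [point](_ : _ = 0)// mule0.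
by move=> x _; exact: FA0.
Qed.

Lemma ge0_integral_polar F (A : set 'rV[R]_m) : (0 < m)%N -> measurable A ->
  measurable_fun setT F -> (forall x, 0 <= F x) -> F 0%R = 0 ->
  \int[lam]_(x in A) F x = \int[mu]_(r in @pos R) \int[sigma r]_(v in A) F v.
Proof.
move=> m0 mA mF F0 F00.
have mFA : measurable_fun setT (F \_ A).
  by apply: (measurable_restrictT _ _).1 => //; exact: measurable_funTS.
have FA0 x : 0 <= (F \_ A) x by apply: erestrict_ge0.
rewrite integral_mkcond ge0_integral_polar_aux//; last first.
  by rewrite patchE F00; case: ifP.
rewrite [RHS]integral_mkcond; apply: eq_integral => r _; rewrite patchE.
case: ifPn => [|rpos].
  by rewrite inE /pos/= in_itv/= andbT => r0; rewrite ge0_integral_surface.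
by apply: integral0_eq => u _; rewrite !indicE (negbTE rpos) !mul0r mul0e.
Qed.

Lemma measurable_integral_surface F (A : set 'rV[R]_m) : measurable A ->
  measurable_fun setT F -> (forall x, 0 <= F x) ->
  measurable_fun (@pos R) (fun r => \int[sigma r]_(v in A) F v).
Proof.
move=> mA mF F0.
have mFA : measurable_fun setT (F \_ A).
  by apply: (measurable_restrictT _ _).1 => //; exact: measurable_funTS.
have FA0 x : 0 <= (F \_ A) x by apply: erestrict_ge0.
apply: (eq_measurable_fun (fun r => \int[lam]_u polar_integrand (F \_ A) (r, u))).
  move=> r; rewrite inE /pos/= in_itv/= andbT => r0.
  by rewrite -ge0_integral_surface.
apply: measurable_funTS.
apply: (measurable_fun_fubini_tonelli_F (polar_integrand (F \_ A))).
  exact: measurable_polar_integrand.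
by move=> p; exact: polar_integrand_ge0.
Qed.

(** [radial r] sends the punctured ball into the sphere of radius r, so the surface measure is
    carried by that sphere: there [phi] is constant, and [A] may be replaced by its trace. *)
Lemma ge0_integral_surface_radial r (phi : R -> R) (g : 'rV[R]_m -> R) (A : set 'rV[R]_m) :
  (0 < r)%R -> measurable A -> measurable_fun setT phi -> measurable_fun setT g ->
  (forall t, 0 <= phi t)%R -> (forall x, 0 <= g x)%R ->
  \int[sigma r]_(v in A) (phi (enorm v) * g v)%:E =
  (phi r)%:E * \int[sigma r]_(v in esphere r `&` A) (g v)%:E.
Proof.
move=> r0 mA mphi mg phi0 g0.
have mS : measurable (esphere r : set 'rV[R]_m).
  rewrite (_ : esphere r = @enorm R m @^-1` [set r])//.
  by rewrite -[X in measurable X]setTI; exact: measurable_enorm.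
have mSA : measurable (esphere r `&` A) by exact: measurableI.
have mgA : measurable_fun setT ((EFin \o g) \_ (esphere r `&` A)).
  by apply: (measurable_restrictT _ _).1 => //; apply/measurable_EFinP/measurable_funTS.
have gA0 x : 0 <= ((EFin \o g) \_ (esphere r `&` A)) x.
  by apply: erestrict_ge0 => y _; rewrite lee_fin.
rewrite !ge0_integral_surface//; first last.
- by move=> x; rewrite lee_fin mulr_ge0.
- by apply/measurable_EFinP; apply: measurable_funM => //; apply: measurableT_comp => //; exact: measurable_enorm.
- exact/measurable_EFinP.
rewrite -ge0_integralZl//; last 3 first.
- exact: (measurableT_comp (measurable_polar_integrand mgA) (measurable_pair1 r)).
- by move=> u _; exact: polar_integrand_ge0.
- by rewrite lee_fin.
apply: eq_integral => u _; rewrite /polar_integrand/= !indicE.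
have [uB|uB] := boolP (u \in B); last by rewrite !(mulr0, mul0r) !mul0e mule0.
rewrite muleCA; congr (_ * _); rewrite !patchE in_setI.
move: uB; rewrite inE => uB.
rewrite [_ \in esphere r]mem_set/=; last exact: radial_esphere.
by case: ifPn => _; rewrite ?mule0// radial_esphere.
Qed.

End surface_integral.

Lemma is_derive1_continuous (R : realType) (f : R -> R) (x df : R) :
  is_derive x 1 f df -> f @ x --> f x.
Proof. by case=> /derivable1_diffP/differentiable_continuous + _; exact. Qed.

(** * The area of the sphere and integrals of radial functions *)

Section radial_integral.
Context (R : realType) (m : nat).
Notation mu := (@lebesgue_measure R).
Notation lam := (lebesgue_rV R m).
Notation B := (@punctured_eball R m).
Notation sigma := (@surface_measure R m).
Local Open Scope ereal_scope.

Lemma measurable_esphere (r : R) : measurable (esphere r : set 'rV[R]_m).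
Proof.
rewrite (_ : esphere r = @enorm R m @^-1` [set r])//.
by rewrite -[X in measurable X]setTI; exact: measurable_enorm.
Qed.

Lemma lebesgue_rV_punctured_eball : lam B < +oo.
Proof.
have := @lebesgue_rV_cube R m 1 ler01 => H.
have mc : measurable [set x : 'rV[R]_m | forall i, (`|x 0 i| <= 1)%R].
  rewrite (_ : mkset _ = \bigcap_(i in [set: 'I_m]) (@rV_coord R m i @^-1` `[(- 1)%R, 1%R])).
    apply: fin_bigcap_measurable => // i _.
    by rewrite -[X in measurable X]setTI; apply: measurable_rV_coord.
  by apply/seteqP; split=> x /= C i => [_|]; have := C i; rewrite /rV_coord/= in_itv/= -ler_norml//; exact.
rewrite (le_lt_trans (y := ((2 * 1) ^+ m)%:E)) ?ltry//.
rewrite -H le_measure ?inE//; first exact: measurable_punctured_eball.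
by move=> x /andP[_ x1] i; rewrite (le_trans (coord_le_enorm x i)).
Qed.

Lemma integral_surface_cst (r : R) : (0 < r)%R ->
  \int[sigma r]_(v in esphere r) 1 = (m%:R * r ^+ m.-1)%:E * lam B.
Proof.
move=> r0.
have mB := @measurable_punctured_eball R m.
rewrite (@ge0_integral_surface _ _ _ (fun=> 1))//; last exact: measurable_esphere.
rewrite -[B in RHS]setIT -integral_indic//.
rewrite -ge0_integralZl//; last 2 first.
- by apply/measurable_EFinP; exact: measurable_indic.
- by rewrite lee_fin mulr_ge0// exprn_ge0// ltW.
apply: eq_integral => u _; rewrite /polar_integrand/= !indicE.
rewrite [r \in _]mem_set/= ?mul1r; last by rewrite /pos/= in_itv/= andbT.
have [uB|uB] := boolP (u \in B); last by rewrite mul0r mul0e mule0.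
move: uB; rewrite inE => uB.
by rewrite mul1r mule1 patchE mem_set ?mule1//; exact: radial_esphere.
Qed.

Lemma sphere_areaE : ((sphere_area R m)%:E = m%:R%:E * lam B).
Proof.
rewrite /sphere_area -[surface_measure _ _ _]mul1e -integral_cst; last exact: measurable_esphere.
rewrite integral_surface_cst// expr1n mulr1 fineK// fin_numM//.
by rewrite ge0_fin_numE// lebesgue_rV_punctured_eball.
Qed.

Lemma sphere_area_ge0 : (0 <= sphere_area R m)%R.
Proof. by rewrite fine_ge0. Qed.

Lemma ge0_integral_radial (phi : R -> R) : (0 < m)%N -> measurable_fun setT phi ->
  (forall t, 0 <= phi t)%R -> phi 0%R = 0%R ->
  \int[lam]_x (phi (enorm x))%:E =
  \int[mu]_(r in @pos R) (phi r * (sphere_area R m * r ^+ m.-1))%:E.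
Proof.
move=> m0 mphi phi0 phi00.
rewrite (@ge0_integral_polar _ _ (fun x => (phi (enorm x))%:E))//; first last.
- by rewrite enorm0 phi00.
- by move=> x; rewrite lee_fin.
- by apply/measurable_EFinP; apply: measurableT_comp => //; exact: measurable_enorm.
apply: eq_integral => r; rewrite inE /pos/= in_itv/= andbT => r0.
under eq_integral do rewrite -[phi _]mulr1.
rewrite (@ge0_integral_surface_radial _ _ r phi (fun=> 1%R))//.
rewrite setIT integral_surface_cst// [RHS]EFinM; congr (_ * _).
by rewrite [RHS]EFinM sphere_areaE [X in X * _]EFinM muleAC.
Qed.

(** A primitive of r^(a-1), the density of |z|^(a-m) in polar coordinates. Its two cases mirror
    those of [counterterm]. *)
Definition radial_primitive (a r : R) : R := if a == 0%R then ln r else (r `^ a / a)%R.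

Lemma is_derive1_radial_primitive (a r : R) : (0 < r)%R ->
  is_derive r 1%R (radial_primitive a) (r `^ (a - 1))%R.
Proof.
move=> r0; rewrite /radial_primitive.
have [->|a0] := eqVneq a 0%R.
  by rewrite sub0r powR_inv1 ?ltW//; exact: is_derive1_ln.
rewrite (_ : (fun _ => _) = (a^-1 \*: (@powR R ^~ a : R -> R))%R); last first.
  by apply/funext => x /=; rewrite /GRing.scale/= mulrC.
apply: is_derive_eq.
  by apply: is_deriveZ; exact: is_derive1_powR.
by rewrite /GRing.scale/= mulrA mulVf// mul1r.
Qed.

(** Polar coordinates turn the kernel into r^(a-m) r^(m-1) = r^(a-1). An exact value is needed, not
    a bound, because the counterterm has to cancel it. *)
Lemma integral_annulus (a e d : R) : (0 < m)%N -> (0 < e)%R -> (e < d)%R ->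
  \int[lam]_(z in [set z | (e < enorm z <= d)%R]) (enorm z `^ (a - m%:R))%:E =
  (sphere_area R m * (radial_primitive a d - radial_primitive a e))%:E.
Proof.
move=> m0 e0 ed.
pose phi (r : R) : R := (\1_(`]e, d]%classic) r * r `^ (a - m%:R))%R.
have mphi : measurable_fun setT phi.
  by apply: measurable_funM; [exact: measurable_indic|exact: measurable_powR].
have phi0 t : (0 <= phi t)%R by rewrite mulr_ge0 ?powR_ge0// indicE.
have phi00 : phi 0%R = 0%R.
  by rewrite /phi indicE memNset ?mul0r//= in_itv/= ltNge ltW.
transitivity (\int[lam]_x (phi (enorm x))%:E).
  rewrite integral_mkcond; apply: eq_integral => x _; rewrite patchE /phi indicE.
  rewrite (_ : (x \in _) = (enorm x \in `]e, d]%classic)); last first.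
    by apply/idP/idP; rewrite !inE/= ?in_itv.
  by case: ifP => _; rewrite ?mul1r// mul0r.
rewrite ge0_integral_radial//.
transitivity (\int[mu]_(r in `]e, d]) (sphere_area R m * r `^ (a - 1))%:E).
  rewrite integral_mkcond [RHS]integral_mkcond; apply: eq_integral => r _.
  rewrite !patchE /phi indicE /pos.
  have [rI|_] := boolP (r \in `]e, d]%classic); last by rewrite mul0r mul0r; case: ifP.
  have r0 : (0 < r)%R.
    by move: rI; rewrite inE/= in_itv/= => /andP[+ _]; exact: lt_trans.
  rewrite mem_set/= ?in_itv/= ?r0// mul1r mulrCA; congr ((_ * _)%:E).
  rewrite -powR_mulrn ?ltW// -powRD; last by rewrite (gt_eqF r0) implybT.
  by congr (_ `^ _)%R; rewrite -[X in (a - X%:R)%R](prednK m0) -natr1; ring.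
rewrite integral_itv_obnd_cbnd; last first.
  apply/measurable_EFinP; apply: measurable_funM => //.
  by apply: measurable_funTS; exact: measurable_powR.
have dP x : (e <= x)%R -> is_derive x 1%R (fun r => sphere_area R m * radial_primitive a r)%R
    (sphere_area R m * x `^ (a - 1))%R.
  move=> ex; apply: is_deriveZ; apply: is_derive1_radial_primitive.
  exact: lt_le_trans ex.
rewrite (@continuous_FTC2 _ _ (fun r => sphere_area R m * radial_primitive a r)%R)//.
- by rewrite -EFinB mulrBr.
- apply: continuous_in_subspaceT => x; rewrite inE/= in_itv/= => /andP[ex _].
  have x0 := lt_le_trans e0 ex.
  apply: cvgM; first exact: cvg_cst.
  exact: (is_derive1_continuous (is_derive1_powR _ x0)).
- split.
  + by move=> x; rewrite in_itv/= => /andP[/ltW /dP []].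
  + by apply: cvg_at_right_filter; exact: (is_derive1_continuous (dP _ (lexx _))).
  + by apply: cvg_at_left_filter; exact: (is_derive1_continuous (dP _ (ltW ed))).
- move=> x; rewrite in_itv/= => /andP[/ltW /dP [_ H] _].
  by rewrite derive1E.
Qed.

Lemma measurable_annulus (e d : R) :
  measurable [set z : 'rV[R]_m | (e < enorm z <= d)%R].
Proof.
rewrite (_ : mkset _ = @enorm R m @^-1` `]e, d]%classic).
  by rewrite -[X in measurable X]setTI; apply: measurable_enorm.
by apply/seteqP; split => x; rewrite /= in_itv.
Qed.

Lemma measurable_enorm_powR (b : R) (D : set 'rV[R]_m) :
  measurable_fun D (fun x => (enorm x `^ b)%:E).
Proof.
apply/measurable_funTS/measurable_EFinP.
apply: (measurableT_comp (measurable_powR b)); exact: measurable_enorm.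
Qed.

Lemma integral_punctured_eball_le (a d : R) : (0 < m)%N -> (0 < a)%R -> (0 < d)%R ->
  \int[lam]_(z in [set z | (0 < enorm z <= d)%R]) (enorm z `^ (a - m%:R))%:E <=
  (sphere_area R m * (d `^ a / a))%:E.
Proof.
move=> m0 a0 d0.
pose A n := [set z : 'rV[R]_m | (n.+1%:R^-1 < enorm z <= d)%R].
have ndA : nondecreasing_seq A.
  move=> k n kn; apply/subsetPset => z /= /andP[nz zd]; rewrite /A/= zd andbT.
  by rewrite (le_lt_trans _ nz)// lef_pV2 ?posrE// ler_nat.
have UA : \bigcup_n A n = [set z : 'rV[R]_m | (0 < enorm z <= d)%R].
  apply/seteqP; split=> [z [n _] /= /andP[nz ->]|z /= /andP[z0 zd]].
    by rewrite andbT (lt_trans _ nz).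
  have [n _ /(_ n (leqnn n)) nz] := near_infty_natSinv_lt (PosNum z0).
  by exists n => //; apply/andP.
have cv : \int[lam]_(z in A n) (enorm z `^ (a - m%:R))%:E @[n --> \oo] -->
    \int[lam]_(z in \bigcup_n A n) (enorm z `^ (a - m%:R))%:E.
  apply: ge0_nondecreasing_set_cvg_integral => // n.
  - exact: measurable_annulus.
  - exact: measurable_enorm_powR.
  - by move=> x _; rewrite lee_fin powR_ge0.
rewrite UA in cv.
rewrite -(cvg_lim _ cv)//.
apply: lime_le; first by apply: cvgP cv.
near=> n.
have nd : (n.+1%:R^-1 < d)%R by near: n; exact: (near_infty_natSinv_lt (PosNum d0)).
rewrite integral_annulus// lee_fin ler_wpM2l ?sphere_area_ge0//.
by rewrite /radial_primitive gt_eqF// gerBl divr_ge0 ?powR_ge0// ltW.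
Unshelve. all: by end_near.
Qed.

End radial_integral.

(** * The balance law and radial weights *)

Section balance.
Context (R : realType) (m : nat) (Om : set 'rV[R]_m) (mOm : measurable Om).
Notation mu := (@lebesgue_measure R).
Notation lam := (lebesgue_rV R m).
Notation sigma := (@surface_measure R m).
Local Open Scope ereal_scope.
Implicit Types (i : 'I_m) (r : R).

(** The polar formula takes nonnegative functions only, so a coordinate enters it through its
    positive and negative parts. *)
Definition coord_pos i (x : 'rV[R]_m) : R := Num.max (x 0%R i) 0%R.
Definition coord_neg i (x : 'rV[R]_m) : R := Num.max (- x 0%R i)%R 0%R.

Lemma coord_pos_ge0 i x : (0 <= coord_pos i x)%R.
Proof. by rewrite le_max lexx orbT. Qed.

Lemma coord_neg_ge0 i x : (0 <= coord_neg i x)%R.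
Proof. by rewrite le_max lexx orbT. Qed.

Lemma coord_pos0 i : coord_pos i 0%R = 0%R.
Proof. by rewrite /coord_pos mxE maxxx. Qed.

Lemma coord_neg0 i : coord_neg i 0%R = 0%R.
Proof. by rewrite /coord_neg mxE oppr0 maxxx. Qed.

Lemma coord_posB i x : (coord_pos i x - coord_neg i x = x 0 i)%R.
Proof. by rewrite /coord_pos /coord_neg; case: leP => h1; case: leP => h2; lra. Qed.

Lemma coord_pos_le i x : (coord_pos i x <= enorm x)%R.
Proof.
by rewrite ge_max enorm_ge0 andbT (le_trans (ler_norm _))// coord_le_enorm.
Qed.

Lemma coord_neg_le i x : (coord_neg i x <= enorm x)%R.
Proof.
rewrite ge_max enorm_ge0 andbT (le_trans (ler_norm _))//.
by rewrite normrN coord_le_enorm.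
Qed.

Lemma measurable_coord_pos i : measurable_fun setT (coord_pos i).
Proof. by apply: measurable_maxr => //; exact: measurable_rV_coord. Qed.

Lemma measurable_coord_neg i : measurable_fun setT (coord_neg i).
Proof.
apply: measurable_maxr => //.
by apply: measurableT_comp => //; exact: measurable_rV_coord.
Qed.

Definition surface_part (g : 'rV[R]_m -> R) r : \bar R :=
  \int[sigma r]_(v in esphere r `&` Om) (g v)%:E.

(** On the sphere g <= r, and the area is proportional to r^(m-1). The bound makes both parts
    finite, hence subtractable, and their densities integrable on segments. *)
Lemma surface_part_le (g : 'rV[R]_m -> R) r : (0 < m)%N -> (0 < r)%R ->
  measurable_fun setT g -> (forall x, 0 <= g x)%R -> (forall x, g x <= enorm x)%R ->
  surface_part g r <= (sphere_area R m * r ^+ m)%:E.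
Proof.
move=> m0 r0 mg g0 ge.
have mS := @measurable_esphere R m r.
have mSO : measurable (esphere r `&` Om) by exact: measurableI.
apply: (@le_trans _ _ (\int[sigma r]_(v in esphere r `&` Om) r%:E)).
  apply: ge0_le_integral => //.
  - by move=> v _; rewrite lee_fin.
  - exact/measurable_funTS/measurable_EFinP.
  - by move=> v [<- _]; rewrite lee_fin.
rewrite integral_cst//.
apply: (@le_trans _ _ (r%:E * sigma r (esphere r))).
  apply: lee_wpmul2l; first by rewrite lee_fin ltW.
  by apply: le_measure; rewrite ?inE//; exact: subIsetl.
rewrite -[sigma r _]mul1e -integral_cst// integral_surface_cst//.
have -> : (r ^+ m = r * r ^+ m.-1)%R by rewrite -exprS prednK.
rewrite [X in _ <= X]EFinM sphere_areaE [X in _ <= X]muleAC -EFinM.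
by rewrite muleA -EFinM mulrCA.
Qed.

Lemma integral_surface_part (phi : R -> R) (g : 'rV[R]_m -> R) : (0 < m)%N ->
  measurable_fun setT phi -> measurable_fun setT g ->
  (forall t, 0 <= phi t)%R -> (forall x, 0 <= g x)%R -> g 0%R = 0%R ->
  \int[lam]_(x in Om) (phi (enorm x) * g x)%:E =
  \int[mu]_(r in @pos R) ((phi r)%:E * surface_part g r).
Proof.
move=> m0 mphi mg phi0 g0 g00.
rewrite (@ge0_integral_polar _ _ (fun x => (phi (enorm x) * g x)%:E))//; last 3 first.
- apply/measurable_EFinP; apply: measurable_funM => //.
  by apply: measurableT_comp => //; exact: measurable_enorm.
- by move=> x; rewrite lee_fin mulr_ge0.
- by rewrite g00 mulr0.
apply: eq_integral => r; rewrite inE /pos/= in_itv/= andbT => r0.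
exact: ge0_integral_surface_radial.
Qed.

Lemma measurable_surface_part (g : 'rV[R]_m -> R) : measurable_fun setT g -> (forall x, 0 <= g x)%R ->
  measurable_fun (@pos R) (surface_part g).
Proof.
move=> mg g0.
(* The domain [esphere r] varies with r; since the measure is carried by the sphere, it can be
   traded for the fixed domain [Om]. *)
apply: (eq_measurable_fun (fun r => \int[sigma r]_(v in Om) (g v)%:E)).
  move=> r; rewrite inE /pos/= in_itv/= andbT => r0.
  rewrite -[RHS]mul1e -(@ge0_integral_surface_radial _ _ r (fun=> 1%R))//.
  by apply: eq_integral => v _; rewrite mul1r.
by apply: measurable_integral_surface => //; exact/measurable_EFinP.
Qed.

Lemma surface_part_fin_num (g : 'rV[R]_m -> R) r : (0 < m)%N -> (0 < r)%R ->
  measurable_fun setT g -> (forall x, 0 <= g x)%R -> (forall x, g x <= enorm x)%R ->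
  surface_part g r \is a fin_num.
Proof.
move=> m0 r0 mg g0 ge; rewrite ge0_fin_numE.
  exact: le_lt_trans (surface_part_le m0 r0 mg g0 ge) (ltry _).
by apply: integral_ge0 => v _; rewrite lee_fin.
Qed.

Lemma balanced_at_gt0P r : (0 < m)%N -> (0 < r)%R ->
  balanced_at Om r <->
  forall i, surface_part (coord_pos i) r = surface_part (coord_neg i) r.
Proof.
move=> m0 r0.
suff H i : (\int[surface_measure m r]_(v in esphere r `&` Om) v 0 i = 0)%R <->
    surface_part (coord_pos i) r = surface_part (coord_neg i) r.
  by split=> H' i; apply/H; exact: H'.
have fP := surface_part_fin_num m0 r0 (@measurable_coord_pos i) (@coord_pos_ge0 i) (@coord_pos_le i).
have fN := surface_part_fin_num m0 r0 (@measurable_coord_neg i) (@coord_neg_ge0 i) (@coord_neg_le i).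
rewrite /Rintegral integralE.
have -> : \int[surface_measure m r]_(x in esphere r `&` Om)
    (fun x : 'rV[R]_m => (x 0%R i)%:E)^\+ x = surface_part (coord_pos i) r.
  by apply: eq_integral => x _; rewrite funeposE /coord_pos EFin_max.
have -> : \int[surface_measure m r]_(x in esphere r `&` Om)
    (fun x : 'rV[R]_m => (x 0%R i)%:E)^\- x = surface_part (coord_neg i) r.
  by apply: eq_integral => x _; rewrite funenegE /coord_neg EFin_max.
rewrite -(fineK fP) -(fineK fN) -EFinB/=; split => [/eqP|[->]].
  by rewrite subr_eq0 => /eqP ->.
by rewrite subrr.
Qed.

Lemma balanced_at0 : balanced_at Om 0.
Proof.
move=> i; rewrite /Rintegral integral0_eq// => v [/eqP + _].
by rewrite enorm_eq0 => /eqP ->; rewrite mxE.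
Qed.

(** In polar coordinates both sides integrate phi(r) times a surface part, and by the balance law
    these parts agree for almost every r. *)
Lemma balance_integral (phi : R -> R) i : (0 < m)%N -> balance_law Om ->
  measurable_fun setT phi -> (forall t, 0 <= phi t)%R ->
  \int[lam]_(x in Om) (phi (enorm x) * coord_pos i x)%:E =
  \int[lam]_(x in Om) (phi (enorm x) * coord_neg i x)%:E.
Proof.
move=> m0 bal mphi phi0.
have mP := @measurable_coord_pos i; have mN := @measurable_coord_neg i.
have P0 := @coord_pos_ge0 i; have N0 := @coord_neg_ge0 i.
rewrite (integral_surface_part m0 mphi mP phi0 P0 (coord_pos0 i)).
rewrite (integral_surface_part m0 mphi mN phi0 N0 (coord_neg0 i)).
apply: ge0_ae_eq_integral.
- exact: measurable_pos.
- apply: emeasurable_funM; last exact: measurable_surface_part.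
  exact/measurable_funTS/measurable_EFinP.
- apply: emeasurable_funM; last exact: measurable_surface_part.
  exact/measurable_funTS/measurable_EFinP.
- by move=> r _; rewrite mule_ge0 ?lee_fin// integral_ge0// => v _; rewrite lee_fin.
- by move=> r _; rewrite mule_ge0 ?lee_fin// integral_ge0// => v _; rewrite lee_fin.
- case: bal => N [mN' muN subN]; exists N; split => // r /= nr; apply: subN => /= br.
  apply: nr; rewrite /pos/= in_itv/= andbT => r0.
  by have /balanced_at_gt0P -/(_ m0 r0) -> := br (ltW r0).
Qed.

Lemma balance_Rintegral (phi : R -> R) i : (0 < m)%N -> balance_law Om ->
  measurable_fun setT phi -> (forall t, 0 <= phi t)%R ->
  (\int[lam]_(x in Om) (phi (enorm x) * x 0 i) = 0)%R.
Proof.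
move=> m0 bal mphi phi0; rewrite /Rintegral integralE.
have -> : \int[lam]_(x in Om) (fun x : 'rV[R]_m => (phi (enorm x) * x 0 i)%:E)^\+ x =
    \int[lam]_(x in Om) (phi (enorm x) * coord_pos i x)%:E.
  apply: eq_integral => x _; rewrite funeposE /coord_pos maxr_pMr// mulr0.
  by rewrite EFin_max.
have -> : \int[lam]_(x in Om) (fun x : 'rV[R]_m => (phi (enorm x) * x 0 i)%:E)^\- x =
    \int[lam]_(x in Om) (phi (enorm x) * coord_neg i x)%:E.
  apply: eq_integral => x _; rewrite funenegE /coord_neg maxr_pMr// mulr0 mulrN.
  by rewrite EFin_max.
rewrite balance_integral//.
(* Should the two equal parts be infinite, their difference is an infinite value, which [fine] sends
   to 0. *)
by case: (\int[lam]_(x in Om) _) => //= r; rewrite subrr.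
Qed.

End balance.

(** * Even moments determine a function on a segment *)

Section even_moments.
Context (R : realType) (M : R) (h : R -> R).
Notation mu := (@lebesgue_measure R).
Hypothesis ih : mu.-integrable `[0, M] (EFin \o h).
Hypothesis moments0 : forall n, \int[mu]_(r in `[0, M]) (h r * r ^+ n.*2) = 0.

Let mh : measurable_fun `[0, M] h.
Proof. by move/measurable_int : ih => /measurable_EFinP. Qed.

Let itvM : measurable (`[0, M]%classic : set (measurableTypeR R)).
Proof. exact: measurable_itv. Qed.

Lemma integrable_mul_bounded (g : R -> R) (C : R) : measurable_fun setT g ->
  (forall r, 0 <= r <= M -> `|g r| <= C) ->
  mu.-integrable `[0, M] (fun r => (h r * g r)%:E).
Proof.
move=> mg gC; apply: (@le_integrable _ _ _ mu _ itvM _ (fun r => C%:E * (EFin \o h) r)%E).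
- apply/measurable_EFinP/measurable_funM => //; exact: measurable_funTS.
- move=> r; rewrite /= in_itv/= => /gC gr.
  rewrite lee_fin normrM [leRHS]normrM mulrC ler_pM//.
  by rewrite (le_trans gr)// ler_norm.
- exact: integrableZl.
Qed.

(* The power series of exp (-(r/c)^(2N)) only has even powers of r. *)
Lemma integral_expR_moments (c : R) (N : nat) : 0 < c -> (0 < N)%N -> 0 < M ->
  \int[mu]_(r in `[0, M]) (h r * expR (- (r / c) ^+ N.*2)) = 0.
Proof.
move=> c0 N0 M0.
pose x (r : R) := - (r / c) ^+ N.*2.
have mx : measurable_fun setT x.
  by apply: measurableT_comp => //; apply: measurable_funX; exact: measurable_funM.
pose C := (M / c) ^+ N.*2.
have xC r : 0 <= r <= M -> `|x r| <= C.
  move=> /andP[r0 rM]; rewrite /x normrN ger0_norm ?exprn_ge0 ?divr_ge0 ?(ltW c0)//.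
  by rewrite lerXn2r ?nnegrE ?divr_ge0 ?(ltW c0)// ?ler_pM2r ?invr_gt0// (le_trans r0).
(* Partial sums of the exponential. On [0, M] they are bounded by exp C, so a multiple of |h|
   dominates and the series can be integrated term by term. *)
pose S n (r : R) := series (exp_coeff (x r)) n.
have mS n : measurable_fun setT (S n).
  rewrite /S /series/=; apply: measurable_sum => k.
  rewrite /exp_coeff/=; apply: measurable_funM => //; exact: measurable_funX.
have SC n r : 0 <= r <= M -> `|S n r| <= expR C.
  move=> /xC xrC; rewrite /S /series/=.
  rewrite (le_trans (ler_norm_sum _ _ _))//.
  rewrite (@le_trans _ _ (series (exp_coeff C) n))//.
    rewrite /series/= ler_sum// => k _.
    rewrite /exp_coeff/= normrM normrX [X in _ * X]ger0_norm// ler_wpM2r//.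
    by rewrite lerXn2r// nnegrE (le_trans _ xrC).
  rewrite /expR; apply: nondecreasing_cvgn_le; last exact: is_cvg_series_exp_coeff.
  apply: nondecreasing_series => k _ _; rewrite /exp_coeff/= divr_ge0// exprn_ge0//.
  by rewrite exprn_ge0// divr_ge0// ltW.
have S0 n : \int[mu]_(r in `[0, M]) (h r * S n r) = 0.
  elim: n => [|n ihn].
    rewrite /Rintegral integral0_eq// => r _.
    by rewrite /S /series/= big_geq// mulr0.
  under eq_Rintegral do rewrite /S seriesSr mulrDr.
  rewrite RintegralD//=; first last.
  - have C0 r : 0 <= r <= M -> `|exp_coeff (x r) n| <= C ^+ n / n`!%:R.
      move=> /xC xrC; rewrite /exp_coeff/= normrM normrX [X in _ * X]ger0_norm// ler_wpM2r//.
      by rewrite lerXn2r// nnegrE (le_trans _ xrC).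
    apply: integrable_mul_bounded C0.
    by rewrite /exp_coeff/=; apply: measurable_funM => //; exact: measurable_funX.
  - by apply: integrable_mul_bounded (SC n).
  - rewrite ihn add0r.
    (* The n-th term of the series contributes a multiple of the moment of order 2Nn. *)
    transitivity (\int[mu]_(r in `[0, M]) (((-1) ^+ n * c^-1 ^+ (N * n).*2 / n`!%:R) * (h r * r ^+ (N * n).*2))).
      apply: eq_Rintegral => r _.
      have -> : exp_coeff (x r) n = (x r) ^+ n / n`!%:R by [].
      have -> : (x r) ^+ n = (-1) ^+ n * (c^-1 ^+ (N * n).*2 * r ^+ (N * n).*2).
        by rewrite /x [LHS]exprNn; congr (_ * _); rewrite doubleMl !exprM mulrC -!exprMn.
      ring.
    rewrite RintegralZl// ?moments0 ?mulr0//.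
    apply: (@integrable_mul_bounded _ (M ^+ (N * n).*2)); first exact: measurable_funX.
    move=> r /andP[r0 rM]; rewrite normrX ger0_norm// lerXn2r// nnegrE//.
    exact: le_trans rM.
have cvgS r : h r * S n r @[n --> \oo] --> h r * expR (x r).
  apply: cvgM; first exact: cvg_cst.
  exact: is_cvg_series_exp_coeff.
have [] := @dominated_convergence _ _ _ mu `[0, M]%classic itvM
  (fun n r => (h r * S n r)%:E) (fun r => (h r * expR (x r))%:E)
  (fun r => (expR C)%:E * `|(h r)%:E|)%E.
- move=> n; apply/measurable_EFinP; apply: measurable_funM => //.
  exact: (measurable_funTS (mS n)).
- apply/measurable_EFinP; apply: measurable_funM => //.
  by apply: measurable_funTS; apply: measurableT_comp.
- by apply: aeW => r _; apply: cvg_EFin; [exact: nearW|exact: cvgS].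
- by apply: integrableZl => //; exact: integrable_abse.
- apply: aeW => r n; rewrite /= in_itv/= => /SC Sr.
  by rewrite lee_fin normrM mulrC ler_wpM2r.
move=> _ _ H; rewrite /Rintegral.
have E0 n : (\int[mu]_(r in `[0%R, M]) (h r * S n r)%:E = 0)%E.
  rewrite -[LHS]fineK; first by congr EFin; exact: S0.
  by apply: integrable_fin_num => //; exact: integrable_mul_bounded (SC n).
have := cvg_unique _ H (_ : _ --> 0%E) => -> //.
rewrite (_ : [sequence _]_n = cst 0%E); first exact: cvg_cst.
exact/funext.
Qed.

(* As N grows, exp (-(r/c)^(2N)) tends to 1 for r < c and to 0 for r > c. *)
Lemma integral_initial_segment (c : R) : 0 < c -> 0 < M ->
  \int[mu]_(r in `[0, M]) (h r * \1_(`]-oo, c]%classic) r) = 0.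
Proof.
move=> c0 M0.
(* With N+1 the exponent is positive; exponent 0 would give the constant exp(-1). *)
pose g (N : nat) (r : R) := expR (- (r / c) ^+ N.+1.*2).
have mg N : measurable_fun setT (g N).
  by do 2 apply: measurableT_comp => //; apply: measurable_funX; exact: measurable_funM.
have g1 N r : `|g N r| <= 1.
  rewrite ger0_norm ?expR_ge0// expR_le1 oppr_le0 -muln2 exprM sqr_ge0//.
have cvg_lt r : 0 <= r < c -> g N r @[N --> \oo] --> (1 : R).
  move=> /andP[r0 rc].
  have z1 : `|(r / c) ^+ 2| < 1.
    by rewrite normrX expr_lt1// ger0_norm ?divr_ge0 ?(ltW c0)// ltr_pdivrMr// mul1r.
  have z0 : - (((r / c) ^+ 2) ^+ N.+1) @[N --> \oo] --> - (0 : R).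
    apply: cvgN; rewrite (cvg_shiftS (fun N => ((r / c) ^+ 2) ^+ N)).
    exact: cvg_expr.
  rewrite -expR0 -oppr0.
  rewrite (_ : (fun N => g N r) = (fun N => expR (- (((r / c) ^+ 2) ^+ N.+1)))); last first.
    by apply/funext => N; rewrite /g -mul2n exprM.
  by apply: (cvg_comp (fun N => - (((r / c) ^+ 2) ^+ N.+1)) (@expR R) z0); exact: continuous_expR.
have cvg_gt r : c < r -> g N r @[N --> \oo] --> (0 : R).
  move=> cr; have r0 := lt_trans c0 cr.
  have z1 : `|(c / r) ^+ 2| < 1.
    by rewrite normrX expr_lt1// ger0_norm ?divr_ge0 ?ltW// ltr_pdivrMr// mul1r.
  have z0 : ((c / r) ^+ 2) ^+ N.+1 @[N --> \oo] --> (0 : R).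
    rewrite (cvg_shiftS (fun N => ((c / r) ^+ 2) ^+ N)).
    exact: cvg_expr.
  (* From exp t >= 1 + t >= t follows exp(-t) <= 1/t, here with t = (r/c)^(2(N+1)). *)
  apply: (squeeze_cvgr _ (cvg_cst 0) z0); apply: nearW => n.
  rewrite expR_ge0/= /g expRN -mul2n -exprM.
  have -> : c / r = (r / c)^-1 by rewrite invf_div.
  rewrite exprVn lef_pV2 ?posrE ?expR_gt0 ?exprn_gt0 ?divr_gt0//.
  by rewrite (le_trans _ (expR_ge1Dx _))// lerDr.
have [] := @dominated_convergence _ _ _ mu `[0, M]%classic itvM
  (fun n r => (h r * g n r)%:E) (fun r => (h r * \1_(`]-oo, c]%classic) r)%:E)
  (fun r => `|(h r)%:E|)%E.
- move=> n; apply/measurable_EFinP; apply: measurable_funM => //.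
  exact: (measurable_funTS (mg n)).
- apply/measurable_EFinP; apply: measurable_funM => //.
(* At r = c every [g N] equals exp(-1), so convergence to the indicator can fail there. *)
- exists [set c]; split => //; first exact: lebesgue_measure_set1.
  move=> r /=; apply: contra_notP => rc rM; apply: cvg_EFin; first exact: nearW.
  apply: cvgM; first exact: cvg_cst.
  move: rM; rewrite in_itv/= => /andP[r0 _].
  rewrite indicE; case: (ltgtP r c) rc => // rc _.
    by rewrite mem_set/= ?in_itv/= ?ltW//; apply: cvg_lt; rewrite r0.
  by rewrite memNset/= ?in_itv/= ?leNgt ?rc//; exact: cvg_gt.
- exact: integrable_abse.
- by apply: aeW => r n _; rewrite lee_fin normrM ler_piMr.
move=> _ _ H; rewrite /Rintegral.
have E0 n : (\int[mu]_(r in `[0%R, M]) (h r * g n r)%:E = 0)%E.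
  rewrite -[LHS]fineK; first by congr EFin; exact: integral_expR_moments.
  by apply: integrable_fin_num => //; exact: integrable_mul_bounded (fun r _ => g1 n r).
have := cvg_unique _ H (_ : _ --> 0%E) => -> //.
rewrite (_ : [sequence _]_n = cst 0%E); first exact: cvg_cst.
exact/funext.
Qed.

Lemma even_moments_ae0 : 0 < M -> {ae mu, forall r : R, 0 < r < M -> h r = 0}.
Proof.
move=> M0.
pose f := h \_ `[0, M].
have intf : mu.-integrable setT (EFin \o f).
  by move: ih => /(integrable_mkcond _ itvM); rewrite restrict_EFin.
have locf : locally_integrable setT f.
  apply: open_integrable_locally => //; exact: openT.
have intfS (y : R) : mu.-integrable [set` Interval (BLeft (0 : R)) (BRight y)] (EFin \o f).
  by apply: integrableS intf.
have F0 (x : R) : 0 < x < M -> \int[mu]_(t in [set` Interval (BLeft (0 : R)) (BRight x)]) f t = 0.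
  move=> /andP[x0 xM].
  rewrite -[RHS](integral_initial_segment x0 M0) Rintegral_mkcond [RHS]Rintegral_mkcond.
  apply: eq_Rintegral => t _; rewrite !patchE indicE.
  rewrite /f patchE !mem_setE !in_itv/=.
  case: (leP 0 t) => t0 //=; case: (leP t x) => tx; last by rewrite mulr0 if_same.
  by rewrite mulr1.
have [N [mN muN subN]] := FTC1 intfS locf.
exists N; split => // r /= nr; apply: subN => /= Hr; apply: nr => /andP[r0 rM].
have /Hr [_] : (0%:E < r%:E)%E by rewrite lte_fin.
rewrite /f patchE mem_set/= ?in_itv/= ?(ltW r0) ?(ltW rM)// => <-.
(* The primitive of [f] vanishes on a neighbourhood of r, so its derivative, which is [f r] at this
   r, is 0. *)
rewrite derive1E (@near_eq_derive _ _ _ _ (cst 0)) ?derive_cst ?oner_eq0//.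
have : \forall x \near r, x \in `]0, M[ by apply: near_in_itvoo; rewrite in_itv/= r0.
by apply: filterS => x; rewrite in_itv/=; exact: F0.
Qed.

End even_moments.

Lemma integrable_bounded_on d (T : measurableType d) (R : realType)
    (mu : {measure set T -> \bar R}) (A : set T) (f : T -> R) (C : R) :
  measurable A -> (mu A < +oo)%E -> measurable_fun A f ->
  (forall x, A x -> `|f x| <= C) -> mu.-integrable A (EFin \o f).
Proof.
move=> mA Aoo mf fC; apply: measurable_bounded_integrable => //.
exists C; split; first exact: num_real.
by move=> B CB x /fC fx; rewrite /= (le_trans fx)// ltW.
Qed.

Lemma lebesgue_rV_bounded (R : realType) (m : nat) (A : set 'rV[R]_m) (M : R) :
  measurable A -> (forall x, A x -> enorm x <= M) -> (lebesgue_rV R m A < +oo)%E.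
Proof.
move=> mA AM; pose C := Num.max M 0.
have C0 : 0 <= C by rewrite le_max lexx orbT.
rewrite (le_lt_trans (y := ((2 * C) ^+ m)%:E)) ?ltry//.
rewrite -lebesgue_rV_cube// le_measure ?inE//.
  rewrite (_ : mkset _ = \bigcap_(i in [set: 'I_m]) (@rV_coord R m i @^-1` `[- C, C])).
    apply: fin_bigcap_measurable => // i _.
    by rewrite -[X in measurable X]setTI; apply: measurable_rV_coord.
  by apply/seteqP; split=> x /= H i => [_|]; have := H i; rewrite /rV_coord/= in_itv/= -ler_norml//; exact.
by move=> x /AM xM i; rewrite (le_trans (coord_le_enorm x i))// le_max xM.
Qed.

(** * From the moments of the body to the balance law *)

Section moments.
Context (R : realType) (m : nat) (Om : set 'rV[R]_m) (mOm : measurable Om) (M : R).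
Hypotheses (m0 : (0 < m)%N) (M0 : 0 < M) (OmM : forall x, Om x -> enorm x <= M).
Notation mu := (@lebesgue_measure R).
Notation lam := (lebesgue_rV R m).

Let Omoo : (lam Om < +oo)%E. Proof. exact: lebesgue_rV_bounded OmM. Qed.

(** Cut off at r <= 0, since the polar formula only concerns r > 0; for the parts considered, [fine]
    loses nothing there, by [surface_part_fin_num]. *)
Definition density (g : 'rV[R]_m -> R) : R -> R := (fine \o surface_part Om g) \_ (@pos R).

(** Polar coordinates with the weight r^(2n), which as an even power is nonnegative on the whole
    line. Spheres of radius greater than M miss [Om], which confines the integral to [0, M]. *)
Lemma density_even_moment (g : 'rV[R]_m -> R) n : measurable_fun setT g ->
  (forall x, 0 <= g x) -> (forall x, g x <= enorm x) -> g 0 = 0 ->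
  mu.-integrable `[0, M] (fun r => (density g r * r ^+ n.*2)%:E) /\
  \int[mu]_(r in `[0, M]) (density g r * r ^+ n.*2) =
  \int[lam]_(x in Om) (enorm x ^+ n.*2 * g x).
Proof.
move=> mg g0 ge g00.
have mpos : measurable (@pos R) by exact: measurable_pos.
have md : measurable_fun setT (density g).
  apply: (measurable_restrictT _ _).1 => //.
  apply: measurableT_comp => //; exact: measurable_surface_part.
have d0 r : 0 <= density g r.
  rewrite /density patchE; case: ifP => // _; rewrite fine_ge0//.
  by apply: integral_ge0 => v _; rewrite lee_fin.
have ev (r : R) : 0 <= r ^+ n.*2 by rewrite -muln2 exprM sqr_ge0.
have dS r : 0 < r -> (density g r)%:E = surface_part Om g r.
  move=> r0; rewrite /density patchE mem_set/= ?fineK//; last by rewrite /pos/= in_itv/= r0.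
  exact: surface_part_fin_num.
split.
  apply: (@integrable_bounded_on _ _ _ _ _ _ (sphere_area R m * M ^+ m * M ^+ n.*2)).
  - exact: measurable_itv.
  - rewrite -[X in (X < _)%E]/(mu `[0, M]) lebesgue_measure_itv/=.
    by case: ifP => _; rewrite ?ltry.
  - by apply: measurable_funTS; apply: measurable_funM => //; exact: measurable_funX.
  - move=> r; rewrite /= in_itv/= => /andP[r0 rM].
    rewrite ger0_norm ?mulr_ge0// ler_pM//; last by rewrite lerXn2r// nnegrE// ltW.
    move: r0; rewrite le_eqVlt => /predU1P[<-|r0].
      rewrite /density patchE memNset/= ?mulr_ge0 ?sphere_area_ge0 ?exprn_ge0 ?(ltW M0)//.
      by rewrite /pos/= in_itv/= ltxx.
    rewrite -lee_fin dS// (le_trans (surface_part_le mOm m0 r0 mg g0 ge))// lee_fin.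
    by rewrite ler_wpM2l ?sphere_area_ge0// lerXn2r// ?nnegrE ltW.
rewrite /Rintegral (@integral_surface_part _ _ _ mOm (fun r => r ^+ n.*2) g)//.
congr fine; rewrite integral_mkcond [RHS]integral_mkcond.
apply: eq_integral => r _; rewrite !patchE /pos !mem_setE !in_itv/= andbT.
have [r0|r0] := leP 0 r => /=; last by rewrite ltNge (ltW r0).
have [->|rn0] := eqVneq (r : R) 0.
  rewrite ltxx (ltW M0) /density patchE memNset/= ?mul0r//.
  by rewrite /pos/= in_itv/= ltxx.
have {}r0 : 0 < r by rewrite lt_neqAle eq_sym rn0.
rewrite r0; case: leP => rM.
  by rewrite EFinM dS// muleC.
rewrite /surface_part (_ : esphere r `&` Om = set0) ?integral_set0 ?mule0//.
by apply/seteqP; split => // x [+ /OmM] => /= ->; rewrite leNgt rM.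
Qed.

Lemma moments_balance :
  (forall n (i : 'I_m), \int[lam]_(x in Om) (enorm x ^+ n.*2 * x 0 i) = 0) ->
  balance_law Om.
Proof.
move=> mom.
have mS (g : 'rV[R]_m -> R) n : measurable_fun setT g -> (forall x, 0 <= g x) ->
    (forall x, g x <= enorm x) ->
    lam.-integrable Om (EFin \o (fun x => enorm x ^+ n.*2 * g x)).
  move=> mg g0 ge; apply: (@integrable_bounded_on _ _ _ _ _ _ (M ^+ n.*2 * M)) => //.
    apply: measurable_funTS; apply: measurable_funM => //.
    by apply: measurable_funX; exact: measurable_enorm.
  move=> x /OmM xM; rewrite ger0_norm ?mulr_ge0 ?exprn_ge0 ?enorm_ge0//.
  rewrite ler_pM ?exprn_ge0 ?enorm_ge0//; last exact: le_trans xM.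
  by rewrite lerXn2r ?nnegrE ?enorm_ge0// ltW.
have ae0 (i : 'I_m) : {ae mu, forall r, 0 < r < M ->
    density (coord_pos i) r - density (coord_neg i) r = 0}.
  pose hP := density (coord_pos i); pose hN := density (coord_neg i).
  have HP n := @density_even_moment _ n (@measurable_coord_pos _ _ i)
    (@coord_pos_ge0 _ _ i) (@coord_pos_le _ _ i) (@coord_pos0 _ _ i).
  have HN n := @density_even_moment _ n (@measurable_coord_neg _ _ i)
    (@coord_neg_ge0 _ _ i) (@coord_neg_le _ _ i) (@coord_neg0 _ _ i).
  have itvM : measurable (`[0, M]%classic : set (measurableTypeR R)) by exact: measurable_itv.
  apply: even_moments_ae0 => //.
  - have [iP _] := HP 0%N; have [iN _] := HN 0%N.
    have := integrableB itvM iP iN.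
    apply: eq_integrable => //.
    by move=> r _ /=; rewrite expr0 !mulr1.
  - move=> n; have [iP eP] := HP n; have [iN eN] := HN n.
    under eq_Rintegral do rewrite mulrBl.
    rewrite RintegralB ?eP ?eN//.
    rewrite -RintegralB//; last 2 first.
    - exact: mS (@measurable_coord_pos _ _ i) (@coord_pos_ge0 _ _ i) (@coord_pos_le _ _ i).
    - exact: mS (@measurable_coord_neg _ _ i) (@coord_neg_ge0 _ _ i) (@coord_neg_le _ _ i).
    under eq_Rintegral do rewrite -mulrBr coord_posB.
    exact: mom.
case: (choice (fun i => ae0 i)) => N HN.
(* The exceptional radii of all m coordinates. The indices k >= m contribute the radius M, about
   which [ae0] says nothing. *)
pose F k := if (insub k : option 'I_m) is Some i then N i else [set M].
have [N' [mN' muN' subN']] : mu.-negligible (\bigcup_k F k).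
  apply: negligible_bigcup => k; rewrite /F; case: insub => [i|].
    by have [mNi Ni0 _] := HN i; exists (N i); split.
  by exists [set M]; split => //; exact: lebesgue_measure_set1.
exists N'; split => // r /= nr; apply: subN'; apply: contrapT => nF; apply: nr.
rewrite le_eqVlt => /predU1P[<-|r0]; first exact: balanced_at0.
have rM : r != M.
  apply/eqP => rM; apply: nF; exists m => //; rewrite /F.
  by case: insubP => [i|_]; [rewrite ltnn|rewrite rM].
apply/balanced_at_gt0P => // i.
have fP := surface_part_fin_num mOm m0 r0 (@measurable_coord_pos _ _ i) (@coord_pos_ge0 _ _ i) (@coord_pos_le _ _ i).
have fN := surface_part_fin_num mOm m0 r0 (@measurable_coord_neg _ _ i) (@coord_neg_ge0 _ _ i) (@coord_neg_le _ _ i).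
have [rltM|] := ltP r M; last first.
  rewrite le_eqVlt eq_sym (negbTE rM)/= => Mr.
  rewrite /surface_part (_ : esphere r `&` Om = set0) ?integral_set0//.
  by apply/seteqP; split => // x [+ /OmM] => /= ->; rewrite leNgt Mr.
have : 0 < r < M -> density (coord_pos i) r - density (coord_neg i) r = 0.
  have [_ _ subN] := HN i; apply: contrapT => nd; apply: nF.
  by exists i => //; rewrite /F valK; exact: subN.
rewrite r0 rltM => /(_ isT)/eqP; rewrite subr_eq0 /density !patchE mem_set/=; last first.
  by rewrite /pos/= in_itv/= r0.
by move=> /eqP H; rewrite -(fineK fP) -(fineK fN) H.
Qed.

End moments.

(** * Differentiability at the origin *)

Section differentiability.
Context (R : realType) (m : nat).

Lemma dotv_linear (xi : 'rV[R]_m) : linear (dotv xi : 'rV[R]_m -> R).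
Proof.
move=> a u v; rewrite /dotv scaler_sumr -big_split/=; apply: eq_bigr => i _.
by rewrite !mxE mulrDr [in RHS]/GRing.scale/= mulrCA.
Qed.

Lemma continuous_dotv (xi : 'rV[R]_m) : continuous (dotv xi : 'rV[R]_m -> R).
Proof.
move=> x; rewrite /dotv; apply: cvg_big => [||i _]; first exact: add_continuous.
  exact: (nbhs_filter x).
apply: (@cvgM _ _ (nbhs x)); first exact: cvg_cst.
exact: coord_continuous.
Qed.

Lemma dotv_delta (xi : 'rV[R]_m) i : dotv xi (delta_mx 0 i) = xi 0 i.
Proof.
rewrite /dotv (bigD1 i)//= mxE !eqxx mulr1 big1 ?addr0// => j ji.
by rewrite mxE eqxx (negbTE ji) mulr0.
Qed.

(** Differentiability at 0 with gradient xi, written with explicit bounds in the Euclidean norm, the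
    one used in all estimates. *)
Definition enorm_diff (V : 'rV[R]_m -> R) (xi : 'rV[R]_m) : Prop :=
  forall e, 0 < e -> exists2 d, 0 < d & forall h, enorm h < d ->
    `|V h - V 0 - dotv xi h| <= e * enorm h.

Lemma enorm_diffP (V : 'rV[R]_m -> R) (xi : 'rV[R]_m) : enorm_diff V xi ->
  differentiable V 0 /\ forall i, 'D_(delta_mx 0 i) V 0 = xi 0 i.
Proof.
move=> H.
pose linmx := GRing.isLinear.Build R 'rV[R]_m R *:%R (dotv xi) (dotv_linear xi).
pose L : {linear 'rV[R]_m -> R} := HB.pack (dotv xi) linmx.
have Lc : continuous L := @continuous_dotv xi.
have Vo : V \o shift (0 : 'rV[R]_m) = cst (V 0) + L +o_ (0 : 'rV[R]_m) id.
  apply/eqaddoP => e e0 /=; apply/nbhs0_enorm.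
  have m1 : 0 < m%:R + 1 :> R by rewrite ltr_wpDl.
  (* The divisor absorbs the factor m between the Euclidean and the sup norm; the 1 keeps it
     positive. *)
  have [d d0 Hd] := H (e / (m%:R + 1)) (divr_gt0 e0 m1).
  exists d => // h hd; rewrite !fctE/= addr0 opprD addrA.
  apply: (le_trans (Hd _ hd)); rewrite mulrAC ler_pdivrMr// -mulrA ler_wpM2l ?(ltW e0)//.
  by rewrite (le_trans (enorm_le_norm h))// mulrC ler_wpM2l// lerDl.
have dV : 'd V (0 : 'rV[R]_m) = L :> (_ -> _) by exact/diff_unique.
have diffV : differentiable V (0 : 'rV[R]_m) by apply/diff_locallyP; rewrite dV.
split => // i; rewrite deriveE// dV; exact: dotv_delta.
Qed.

(** The potentials are affine functions of a better integral only near the origin, which is all that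
    the gradient there sees. *)
Lemma enorm_diff_near (V W : 'rV[R]_m -> R) (xi : 'rV[R]_m) (s c d : R) :
  0 < d -> (forall x, enorm x < d -> W x = s * V x + c) ->
  enorm_diff V xi -> enorm_diff W (s *: xi).
Proof.
move=> d0 WV HV e e0.
have s1 : 0 < `|s| + 1 by rewrite ltr_wpDl.
have [r r0 Hr] := HV (e / (`|s| + 1)) (divr_gt0 e0 s1).
exists (Num.min d r); first by rewrite lt_min d0.
move=> h; rewrite lt_min => /andP[hd hr].
rewrite !WV ?enorm0//.
have -> : dotv (s *: xi) h = s * dotv xi h.
  by rewrite /dotv mulr_sumr; apply: eq_bigr => i _; rewrite mxE mulrA.
have -> : s * V h + c - (s * V 0 + c) - s * dotv xi h =
    s * (V h - V 0 - dotv xi h) by ring.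
rewrite normrM; apply: (@le_trans _ _ (`|s| * (e / (`|s| + 1) * enorm h))).
  by rewrite ler_wpM2l// Hr.
rewrite mulrA ler_wpM2r ?enorm_ge0// mulrCA ler_piMr ?(ltW e0)//.
by rewrite ler_pdivrMr// mul1r lerDl.
Qed.

End differentiability.

(** * Taylor bounds in one variable *)

Section taylor.
Context (R : realType).
Implicit Types (f df ddf : R -> R).

(** No order of s and t is assumed; the position of c is expressed by distances, the form in which
    the Taylor bound uses it. *)
Lemma MVT_between f df (l u s t : R) : l <= s <= u -> l <= t <= u ->
  (forall x, l <= x <= u -> is_derive x 1 f (df x)) ->
  exists c, [/\ l <= c <= u, `|c - s| <= `|t - s|, `|c - t| <= `|t - s| &
    f t - f s = df c * (t - s)].
Proof.
move=> /andP[ls su] /andP[lt tu] fdf.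
wlog st : s t ls su lt tu / s <= t.
  move=> H; have [st|/ltW ts] := leP s t; first exact: H.
  have [c [lc ct cs E]] := H t s lt tu ls su ts.
  exists c; split => //; try by rewrite [leRHS]distrC.
  by rewrite -[LHS]opprB E -mulrN opprB.
have [] := @MVT_segment _ f df s t st.
- move=> x; rewrite in_itv/= => /andP[sx xt]; apply: fdf.
  by rewrite (le_trans ls (ltW sx)) (le_trans (ltW xt) tu).
- apply: continuous_in_subspaceT => x; rewrite inE/= in_itv/= => /andP[sx xt].
  apply: is_derive1_continuous; apply: fdf.
  by rewrite (le_trans ls sx) (le_trans xt tu).
move=> c; rewrite in_itv/= => /andP[sc ct] E; exists c; split => //.
  by rewrite (le_trans ls sc) (le_trans ct tu).
  by rewrite !ger0_norm ?subr_ge0// lerD2r.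
by rewrite distrC !ger0_norm ?subr_ge0// lerD2l lerN2.
Qed.

(** The mean value theorem for f turns the error into (df c - df s) (t - s), and for df it bounds
    the first factor. The constant L, not L/2, is enough. *)
Lemma taylor1_le f df ddf (l u L : R) :
  (forall x, l <= x <= u -> is_derive x 1 f (df x)) ->
  (forall x, l <= x <= u -> is_derive x 1 df (ddf x)) ->
  (forall x, l <= x <= u -> `|ddf x| <= L) ->
  forall s t, l <= s <= u -> l <= t <= u ->
    `|df t - df s| <= L * `|t - s| /\
    `|f t - f s - df s * (t - s)| <= L * `|t - s| ^+ 2.
Proof.
move=> d1 d2 dL.
have lip s t : l <= s <= u -> l <= t <= u -> `|df t - df s| <= L * `|t - s|.
  move=> ls lt; have [c [lc _ _ ->]] := MVT_between ls lt d2.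
  by rewrite normrM ler_wpM2r// dL.
move=> s t ls lt; split; first exact: lip.
have [c [lc cs _ ->]] := MVT_between ls lt d1.
rewrite -mulrBl normrM expr2 mulrA ler_wpM2r//.
apply: (le_trans (lip _ _ ls lc)); rewrite ler_wpM2l//.
exact: le_trans (dL _ ls).
Qed.

(** Continued below l along the tangent, the function stays C^1 if f is; its derivative is
    [df (Num.max t l)], Lipschitz if df is. *)
Definition tangent_ext f df (l t : R) : R :=
  if l <= t then f t else f l + df l * (t - l).

Lemma tangent_ext_taylor f df ddf (l u L : R) : l <= u ->
  (forall x, l <= x <= u -> is_derive x 1 f (df x)) ->
  (forall x, l <= x <= u -> is_derive x 1 df (ddf x)) ->
  (forall x, l <= x <= u -> `|ddf x| <= L) ->
  forall s t, s <= u -> t <= u ->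
    `|tangent_ext f df l t - tangent_ext f df l s - df (Num.max s l) * (t - s)|
      <= 2 * L * `|t - s| ^+ 2.
Proof.
move=> lu d1 d2 dL s t su tu.
have T := taylor1_le d1 d2 dL.
have L0 : 0 <= L by apply: le_trans (dL l _); rewrite ?lexx.
have ll : l <= l <= u by rewrite lexx.
rewrite /tangent_ext; have [ls|sl] := leP l s; have [lt|tl] := leP l t.
- have [_ H] := T s t (introT andP (conj ls su)) (introT andP (conj lt tu)).
  rewrite (le_trans H)// -mulrA ler_peMl// ?ler1n// mulr_ge0//.
- have ls' : l <= s <= u by rewrite ls.
  have [H1 H2] := T s l ls' ll.
  (* The segment crosses l and is split there: down to l the error is that of f, beyond it the two
     slopes differ. Each piece costs L |t - s|^2, whence the factor 2. *)
  have -> : f l + df l * (t - l) - f s - df s * (t - s) =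
     (f l - f s - df s * (l - s)) + (df l - df s) * (t - l) by ring.
  apply: (le_trans (ler_normD _ _)).
  rewrite -mulrA mulr_natl mulr2n lerD//.
    apply: (le_trans H2); rewrite ler_wpM2l// lerXn2r ?nnegrE//.
    by rewrite ler0_norm ?ler0_norm; lra.
  rewrite normrM expr2 mulrA ler_pM//.
    apply: (le_trans H1); rewrite ler_wpM2l//.
    by rewrite ler0_norm ?ler0_norm; lra.
  by rewrite ler0_norm ?ler0_norm; lra.
- have lt' : l <= t <= u by rewrite lt.
  have [_ H] := T l t ll lt'.
  have -> : f t - (f l + df l * (s - l)) - df l * (t - s) =
     f t - f l - df l * (t - l) by ring.
  rewrite (le_trans H)// -mulrA mulr_natl mulr2n ler_wpDr ?mulr_ge0//.
  rewrite ler_wpM2l// lerXn2r ?nnegrE// ger0_norm ?ger0_norm; lra.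
- have -> : f l + df l * (t - l) - (f l + df l * (s - l)) - df l * (t - s) = 0 by ring.
  by rewrite normr0 !mulr_ge0.
Qed.

End taylor.

(** * Radial kernels *)

Lemma Rintegral_sum d (T : measurableType d) (R : realType)
    (mu : {measure set T -> \bar R}) (D : set T) (I : Type) (s : seq I) (f : I -> T -> R) :
  measurable D -> (forall i, mu.-integrable D (EFin \o f i)) ->
  mu.-integrable D (EFin \o (fun x => \sum_(i <- s) f i x)) /\
  \int[mu]_(x in D) (\sum_(i <- s) f i x) = \sum_(i <- s) \int[mu]_(x in D) f i x.
Proof.
move=> mD fi; elim: s => [|i s [ihi ihe]].
  split.
    rewrite (_ : _ \o _ = cst 0%E); first exact: integrable0.
    by apply/funext => x /=; rewrite big_nil.
  under eq_Rintegral do rewrite big_nil.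
  by rewrite big_nil Rintegral_cst// mul0r.
split.
  have := integrableD mD (fi i) ihi.
  by apply: eq_integrable => // x _ /=; rewrite big_cons.
under eq_Rintegral do rewrite big_cons.
by rewrite RintegralD// ihe big_cons.
Qed.

(** Differentiation under the integral sign. The majorant [w] of the error may depend on h and need
    only have a small integral: it is a constant for the smoothed kernel, and has a singularity
    moving with h for the singular one. *)
Lemma enorm_diff_integral (R : realType) (m : nat) d (T : measurableType d)
    (mu : {measure set T -> \bar R}) (D : set T) (k : 'rV[R]_m -> T -> R)
    (xi : 'I_m -> T -> R) :
  measurable D -> mu.-integrable D (EFin \o k 0) ->
  (forall i, mu.-integrable D (EFin \o xi i)) ->
  (forall e, 0 < e -> exists2 d, 0 < d & forall h, enorm h < d ->
     mu.-integrable D (EFin \o k h) /\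
     exists w : T -> \bar R, [/\ measurable_fun D w, forall y, D y -> (0 <= w y)%E,
       {ae mu, forall y, D y ->
         (`|k h y - k 0%R y - \sum_(i < m) h ord0 i * xi i y|%:E <= w y)%E} &
       (\int[mu]_(y in D) w y <= (e * enorm h)%:E)%E]) ->
  enorm_diff (fun h => \int[mu]_(y in D) k h y)
    (\row_i \int[mu]_(y in D) xi i y).
Proof.
move=> mD ik0 ixi H.
set v := \row_i _.
move=> e e0; have [r r0 Hr] := H e e0; exists r => // h /Hr [ikh [w [mw w0 aew le]]].
have ihx i : mu.-integrable D (EFin \o (fun y => h 0 i * xi i y)).
  by apply: eq_integrable (integrableZl mD (h 0 i) (ixi i)) => // y _; rewrite /= EFinM.
have [isum esum] := @Rintegral_sum _ _ _ mu D _ (index_enum 'I_m)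
  (fun i y => h 0 i * xi i y) mD ihx.
have idiff : mu.-integrable D (EFin \o (fun y => k h y - k 0 y)).
  by apply: eq_integrable (integrableB mD ikh ik0) => // y _.
have iall : mu.-integrable D (EFin \o (fun y => k h y - k 0 y - \sum_(i < m) h 0 i * xi i y)).
  by apply: eq_integrable (integrableB mD idiff isum) => // y _.
have -> : dotv v h = \int[mu]_(y in D) (\sum_(i < m) h 0 i * xi i y).
  rewrite esum; apply: eq_bigr => i _.
  by rewrite mxE RintegralZl// mulrC.
rewrite -RintegralB// -RintegralB//.
apply: (le_trans (le_normr_Rintegral mD iall)).
rewrite -lee_fin; apply: le_trans le; rewrite /Rintegral fineK; last first.
  have := integrable_fin_num mD (integrable_abse iall); exact.
apply: ae_ge0_le_integral => //.
by apply/measurable_EFinP/measurableT_comp => //; apply/measurable_EFinP; exact: measurable_int iall.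
Qed.

Section radial_kernel.
Context (R : realType).
Implicit Types (a b d t : R).

(* The radial profile of the potential of order [b + m], and the factor of
   [a^(b-1)] in its derivative. *)
Definition rkernel b a : R := if b == 0 then ln a else a `^ b.
Definition rcoef b : R := if b == 0 then 1 else b.

(* The kernel is smoothed at the origin as a function of the squared radius,
   which is a polynomial in the coordinates. *)
Definition sqkernel b t : R := if b == 0 then ln t / 2 else t `^ (b / 2).
Definition dsqkernel b t : R := rcoef b / 2 * t `^ (b / 2 - 1).
Definition ddsqkernel b t : R := rcoef b / 2 * ((b / 2 - 1) * t `^ (b / 2 - 2)).

Lemma sqkernelE b a : 0 <= a -> sqkernel b (a ^+ 2) = rkernel b a.
Proof.
move=> a0; rewrite /sqkernel /rkernel; case: ifP => b0.
  move: a0; rewrite le_eqVlt => /predU1P[<-|a0]; first by rewrite expr0n/= ln0// mul0r.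
  by rewrite lnXn// mulr2n; lra.
by rewrite -powR_mulrn// -powRrM; congr (_ `^ _); field.
Qed.

Lemma is_derive_sqkernel b t : 0 < t -> is_derive t 1 (sqkernel b) (dsqkernel b t).
Proof.
move=> t0; rewrite /sqkernel /dsqkernel /rcoef; have [->|b0] := eqVneq b 0.
  rewrite (_ : (fun _ => _) = (2^-1 \*: (@ln R))%R); last first.
    by apply/funext => x /=; rewrite /GRing.scale/= mulrC.
  apply: is_derive_eq; first by apply: is_deriveZ; exact: is_derive1_ln.
  by rewrite /GRing.scale/= mul0r sub0r powR_inv1 ?ltW//; lra.
apply: is_derive_eq; first exact: is_derive1_powR.
by [].
Qed.

Lemma is_derive_dsqkernel b t : 0 < t -> is_derive t 1 (dsqkernel b) (ddsqkernel b t).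
Proof.
move=> t0; rewrite /dsqkernel /ddsqkernel.
apply: is_derive_eq.
  by apply: is_deriveZ; exact: is_derive1_powR.
rewrite /GRing.scale/=; congr (_ * (_ * _ `^ _)); lra.
Qed.

(** Powers are monotone, in a direction that depends on the sign of b; the sum of the end values
    covers both. *)
Lemma powR_le_ends b l t u : 0 < l -> l <= t <= u -> t `^ b <= l `^ b + u `^ b.
Proof.
move=> l0 /andP[lt tu]; have t0 := lt_le_trans l0 lt.
have u0 := lt_le_trans t0 tu.
have [b0|b0] := leP 0 b.
  by rewrite ler_wpDl ?powR_ge0// ge0_ler_powR// nnegrE ltW.
rewrite ler_wpDr ?powR_ge0// -[b]opprK [leLHS]powRN [leRHS]powRN lef_pV2 ?posrE ?powR_gt0//.
by rewrite ge0_ler_powR ?nnegrE ?oppr_ge0 ?(ltW b0) ?(ltW l0) ?(ltW t0).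
Qed.

(** The threshold [d] is a squared radius. Below it the kernel is affine in |z|^2, hence smooth
    through the origin. *)
Definition skernel m b d (z : 'rV[R]_m) : R :=
  tangent_ext (sqkernel b) (dsqkernel b) d (enorm z ^+ 2).

Lemma skernelE m b d (z : 'rV[R]_m) : d <= enorm z ^+ 2 -> skernel b d z = rkernel b (enorm z).
Proof. by move=> dz; rewrite /skernel /tangent_ext dz sqkernelE ?enorm_ge0. Qed.

Lemma measurable_sqkernel b : measurable_fun setT (sqkernel b).
Proof.
rewrite /sqkernel; case: (b == 0); last exact: measurable_powR.
by apply: measurable_funM => //; exact: measurable_ln.
Qed.

Lemma measurable_rkernel b : measurable_fun setT (rkernel b).
Proof.
by rewrite /rkernel; case: (b == 0); [exact: measurable_ln|exact: measurable_powR].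
Qed.

Lemma measurable_skernel m b d : measurable_fun setT (@skernel m b d).
Proof.
have me : measurable_fun setT (fun z : 'rV[R]_m => enorm z ^+ 2).
  by apply: measurable_funX; exact: measurable_enorm.
rewrite /skernel /tangent_ext; apply: measurable_fun_ifT.
- exact: measurable_fun_ler.
- exact: (measurableT_comp (measurable_sqkernel b) me).
- apply: measurable_funD => //; apply: measurable_funM => //.
  exact: measurable_funB.
Qed.

Lemma tangent_ext_sqkernel_taylor b d M : 0 < d -> d <= M -> exists L Q,
  [/\ 0 <= L, 0 <= Q,
    forall t, d <= t <= M -> `|dsqkernel b t| <= Q &
    forall s t, s <= M -> t <= M ->
      `|tangent_ext (sqkernel b) (dsqkernel b) d t
        - tangent_ext (sqkernel b) (dsqkernel b) d s
        - dsqkernel b (Num.max s d) * (t - s)| <= L * `|t - s| ^+ 2].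
Proof.
move=> d0 dM.
pose L := `|rcoef b / 2 * (b / 2 - 1)| * (d `^ (b / 2 - 2) + M `^ (b / 2 - 2)).
have L0 : 0 <= L by rewrite mulr_ge0// addr_ge0// powR_ge0.
pose Q := `|rcoef b / 2| * (d `^ (b / 2 - 1) + M `^ (b / 2 - 1)).
have d1 x : d <= x <= M -> is_derive x 1 (sqkernel b) (dsqkernel b x).
  by move=> /andP[dx _]; apply: is_derive_sqkernel; exact: lt_le_trans dx.
have d2 x : d <= x <= M -> is_derive x 1 (dsqkernel b) (ddsqkernel b x).
  by move=> /andP[dx _]; apply: is_derive_dsqkernel; exact: lt_le_trans dx.
have dL x : d <= x <= M -> `|ddsqkernel b x| <= L.
  move=> dx; rewrite /ddsqkernel mulrA normrM ler_wpM2l//.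
  by rewrite ger0_norm ?powR_ge0//; exact: powR_le_ends.
have T := tangent_ext_taylor dM d1 d2 dL.
exists (2 * L), Q; split => //.
- by rewrite mulr_ge0.
- by rewrite mulr_ge0// addr_ge0// powR_ge0.
- move=> x dx; rewrite /dsqkernel normrM ler_wpM2l//.
  by rewrite ger0_norm ?powR_ge0//; exact: powR_le_ends.
Qed.

Lemma skernel_taylor m b d r : 0 < d -> exists2 C, 0 <= C &
  forall y h : 'rV[R]_m, enorm y <= r -> enorm h <= 1 ->
  `|skernel b d (h - y) - skernel b d (0 - y)
     + 2 * dsqkernel b (Num.max (enorm y ^+ 2) d) * dotv h y| <= C * enorm h ^+ 2.
Proof.
move=> d0.
(* Bounds |y|^2 and, as |h| <= 1, also |h - y|^2. *)
pose M := Num.max d ((`|r| + 1) ^+ 2).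
have dM : d <= M by rewrite le_max lexx.
have [L [Q [L0 Q0 qQ T]]] := tangent_ext_sqkernel_taylor b d0 dM.
(* The squared distance changes by |h|^2 - 2 h.y, at most (2|r| + 1) |h| in size, which gives the
   first summand; [Q] accounts for the part |h|^2 of this change in the first-order term. *)
exists (L * (2 * `|r| + 1) ^+ 2 + Q).
  by rewrite addr_ge0// mulr_ge0// sqr_ge0.
move=> y h yr h1.
have yr' : enorm y <= `|r| by rewrite (le_trans yr)// ler_norm.
have sM : enorm y ^+ 2 <= M.
  rewrite le_max; apply/orP; right; rewrite lerXn2r ?nnegrE ?enorm_ge0 ?addr_ge0//.
  by rewrite (le_trans yr')// lerDl.
have tM : enorm (h - y) ^+ 2 <= M.
  rewrite le_max; apply/orP; right; rewrite lerXn2r ?nnegrE ?enorm_ge0 ?addr_ge0//.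
  by rewrite (le_trans (enormD _ _))// enormN addrC lerD.
have := T _ _ sM tM; set q := dsqkernel b _; set s := enorm y ^+ 2 => H.
have qb : `|q| <= Q by apply: qQ; rewrite le_max lexx orbT ge_max sM dM.
have tsE : enorm (h - y) ^+ 2 - s = enorm h ^+ 2 - 2 * dotv h y.
  rewrite enormD_sqr enormN /s.
  have -> : dotv h (- y) = - dotv h y.
    by rewrite /dotv -sumrN; apply: eq_bigr => i _; rewrite mxE mulrN.
  ring.
rewrite /skernel sub0r enormN -/s.
set A := tangent_ext _ _ _ _ in H *; set B := tangent_ext _ _ _ _ in H *.
have -> : A - B + 2 * q * dotv h y =
   (A - B - q * (enorm (h - y) ^+ 2 - s)) + q * enorm h ^+ 2 by rewrite tsE; ring.
apply: (le_trans (ler_normD _ _)); rewrite mulrDl lerD//; last first.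
  by rewrite normrM [X in _ * X]ger0_norm ?sqr_ge0// ler_wpM2r// sqr_ge0.
apply: (le_trans H); rewrite -mulrA ler_wpM2l// -exprMn lerXn2r ?nnegrE ?mulr_ge0 ?addr_ge0 ?enorm_ge0//.
rewrite tsE; apply: (le_trans (ler_normB _ _)).
rewrite (_ : (2 * `|r| + 1) * enorm h = enorm h + 2 * `|r| * enorm h); last by ring.
rewrite [leLHS]addrC [leRHS]addrC; apply: lerD.
  rewrite normrM ger0_norm// -mulrA ler_wpM2l// (le_trans (dotv_le _ _))// mulrC.
  by rewrite ler_wpM2r ?enorm_ge0.
by rewrite ger0_norm ?sqr_ge0// expr2 ler_piMl ?enorm_ge0.
Qed.

Lemma skernel_bounded m b d r : 0 < d -> exists C, forall z : 'rV[R]_m,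
  enorm z <= r -> `|skernel b d z| <= C.
Proof.
move=> d0.
pose M := Num.max d (`|r| ^+ 2).
have dM : d <= M by rewrite le_max lexx.
have [L [Q [L0 Q0 qQ T]]] := tangent_ext_sqkernel_taylor b d0 dM.
(* Taylor's bound based at t = d: value, first-order term and remainder. *)
exists (`|sqkernel b d| + Q * M + L * M ^+ 2) => z zr.
have zM : enorm z ^+ 2 <= M.
  rewrite le_max; apply/orP; right; rewrite lerXn2r ?nnegrE ?enorm_ge0//.
  by rewrite (le_trans zr)// ler_norm.
have := T _ _ dM zM; rewrite maxxx {2}/tangent_ext lexx -/(skernel b d z) => H.
set t := enorm z ^+ 2 in zM H *.
have tdM : `|t - d| <= M.
  have t0 : 0 <= t by rewrite sqr_ge0.
  by rewrite ler_norml; move: zM dM t0 d0; lra.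
rewrite -[X in `|X|](subrK (sqkernel b d + dsqkernel b d * (t - d))) addrC.
apply: (le_trans (ler_normD _ _)); apply: lerD.
  apply: (le_trans (ler_normD _ _)); rewrite lerD2l normrM ler_pM//.
  by rewrite qQ// lexx.
rewrite opprD addrA; apply: (le_trans H); rewrite ler_wpM2l//.
by rewrite lerXn2r ?nnegrE// (le_trans _ tdM).
Qed.

End radial_kernel.

(** * Potentials away from the boundary *)

Section reflection.
Context (R : realType) (m : nat).
Notation lam := (lebesgue_rV R m).
Local Open Scope ereal_scope.

Lemma measurable_reflect (x : 'rV[R]_m) :
  measurable_fun [set: 'rV[R]_m] (fun y => x - y)%R.
Proof.
rewrite (_ : (fun _ => _) = (fun y => (-1) *: y + x)%R).
  exact: measurable_rV_affine.
by apply/funext => y; rewrite scaleN1r addrC.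
Qed.

Lemma ge0_integral_reflect (x : 'rV[R]_m) (F : 'rV[R]_m -> \bar R) :
  measurable_fun setT F -> (forall z, 0 <= F z) ->
  \int[lam]_y F (x - y)%R = \int[lam]_z F z.
Proof.
move=> mF F0.
have := @ge0_integral_rV_affine R m (-1) x F _ mF F0.
rewrite oppr_eq0 oner_eq0 normrN1 expr1n invr1 mul1e => /(_ isT) <-.
by apply: eq_integral => y _; rewrite scaleN1r addrC.
Qed.

Lemma integral_reflect (x : 'rV[R]_m) (F : 'rV[R]_m -> \bar R) :
  measurable_fun setT F -> \int[lam]_y F (x - y)%R = \int[lam]_z F z.
Proof.
move=> mF; rewrite [LHS]integralE [RHS]integralE.
rewrite -(@ge0_integral_reflect x F^\+)//; last exact: measurable_funepos.
rewrite -(@ge0_integral_reflect x F^\-)//; last exact: measurable_funeneg.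
by congr (_ - _); apply: eq_integral => y _; rewrite ?funeposE ?funenegE.
Qed.

(** Moves a singularity at x to the origin, so that integrals over balls around x no longer depend
    on x. *)
Lemma integral_reflect_in (x : 'rV[R]_m) (A : set 'rV[R]_m) (f : 'rV[R]_m -> \bar R) :
  measurable A -> measurable_fun setT f ->
  \int[lam]_(y in [set y | A (x - y)%R]) f (x - y)%R = \int[lam]_(z in A) f z.
Proof.
move=> mA mf; rewrite [RHS]integral_mkcond -(@integral_reflect x).
  rewrite integral_mkcond; apply: eq_integral => y _.
  by rewrite !patchE; congr (if _ then _ else _).
by apply: (measurable_restrictT _ _).1 => //; exact: measurable_funTS.
Qed.

End reflection.

Section smooth_potential.
Context (R : realType) (m : nat) (Om : set 'rV[R]_m) (mOm : measurable Om) (rho : R).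
Hypotheses (m0 : (0 < m)%N) (Omr : forall x, Om x -> enorm x <= rho).
Notation lam := (lebesgue_rV R m).

Let Omoo : (lam Om < +oo)%E. Proof. exact: lebesgue_rV_bounded Omr. Qed.

Lemma integrable_skernel b d (x : 'rV[R]_m) (D : set 'rV[R]_m) : 0 < d ->
  measurable D -> D `<=` Om ->
  lam.-integrable D (EFin \o (fun y => skernel b d (x - y))).
Proof.
move=> d0 mD DOm; have [C HC] := @skernel_bounded R m b d (enorm x + rho) d0.
apply: (@integrableS _ _ _ _ Om) => //.
apply: (@integrable_bounded_on _ _ _ _ _ _ C) => //.
  apply: measurable_funTS.
  exact: (measurableT_comp (@measurable_skernel R m b d) (measurable_reflect x)).
move=> y /Omr yr; apply: HC; rewrite (le_trans (enormD _ _))// enormN.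
by rewrite lerD2l.
Qed.

(** The partial derivatives of [skernel b d (x - y)] at x = 0: the factor -2 y_i from |x - y|^2
    meets the 1/2 in [dsqkernel]. A radial weight times a coordinate is what [balance_Rintegral]
    annihilates. *)
Definition skernel_gradient b d (i : 'I_m) (y : 'rV[R]_m) : R :=
  - rcoef b * (Num.max (enorm y ^+ 2) d `^ (b / 2 - 1) * y 0 i).

Lemma measurable_max_enorm b d :
  measurable_fun setT (fun r : R => Num.max (r ^+ 2) d `^ b).
Proof.
apply: (measurableT_comp (measurable_powR b)).
by apply: measurable_maxr => //; exact: measurable_funX.
Qed.

Lemma integrable_skernel_gradient b d i : 0 < d ->
  lam.-integrable Om
    (EFin \o (fun y : 'rV[R]_m => Num.max (enorm y ^+ 2) d `^ (b / 2 - 1) * y 0 i)).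
Proof.
move=> d0.
pose M := Num.max (rho ^+ 2) d.
apply: (@integrable_bounded_on _ _ _ _ _ _
   ((d `^ (b / 2 - 1) + M `^ (b / 2 - 1)) * rho)) => //.
  apply: measurable_funTS; apply: measurable_funM; last exact: measurable_rV_coord.
  exact: (measurableT_comp (measurable_max_enorm _ _) (@measurable_enorm R m)).
move=> y /Omr yr; rewrite normrM ler_pM//; last exact: le_trans (coord_le_enorm y i) yr.
rewrite ger0_norm ?powR_ge0//; apply: powR_le_ends => //.
rewrite le_max lexx orbT ge_max !le_max lexx orbT andbT.
by rewrite lerXn2r ?nnegrE ?enorm_ge0// (le_trans (enorm_ge0 y)).
Qed.

Lemma skernel_potential_diff b d : 0 < d ->
  enorm_diff (fun x => \int[lam]_(y in Om) skernel b d (x - y))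
    (\row_i \int[lam]_(y in Om) skernel_gradient b d i y).
Proof.
move=> d0.
have [C C0 HC] := @skernel_taylor R m b d rho d0.
apply: enorm_diff_integral => //.
- exact: integrable_skernel.
- move=> i; have := integrableZl mOm (- rcoef b) (@integrable_skernel_gradient b d i d0).
  by apply: eq_integrable.
move=> e e0.
pose l := fine (lam Om).
have l0 : 0 <= l by rewrite fine_ge0.
have Cl : 0 < C * l + 1 by rewrite ltr_wpDl// mulr_ge0.
(* The error C |h|^2 integrates to C l |h|^2, which is at most e |h| for such h. *)
exists (Num.min 1 (e / (C * l + 1))); first by rewrite lt_min ltr01 divr_gt0.
move=> h; rewrite lt_min => /andP[h1 he]; split; first exact: integrable_skernel.
exists (fun=> (C * enorm h ^+ 2)%:E); split => //.
- by move=> y _; rewrite lee_fin mulr_ge0// sqr_ge0.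
- apply: aeW => y /Omr yr; rewrite lee_fin.
  have := HC y h yr (ltW h1); congr (`| _ | <= _).
  have -> : \sum_(i < m) h 0 i * skernel_gradient b d i y =
     - (rcoef b * Num.max (enorm y ^+ 2) d `^ (b / 2 - 1)) * dotv h y.
    by rewrite /dotv mulr_sumr; apply: eq_bigr => i _; rewrite /skernel_gradient; ring.
  by rewrite /dsqkernel; field.
have lE : lam Om = l%:E by rewrite fineK// ge0_fin_numE.
rewrite integral_cst// [X in (_ * X)%E]lE -EFinM lee_fin -/l expr2 mulrA mulrAC ler_wpM2r ?enorm_ge0//.
rewrite mulrAC (le_trans (y := (C * l + 1) * enorm h))//.
  by rewrite ler_wpM2r ?enorm_ge0// lerDl.
by move: he; rewrite ltr_pdivlMr// mulrC => /ltW.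
Qed.

Lemma balance_skernel_gradient b d i : 0 < d -> balance_law Om ->
  \int[lam]_(y in Om) skernel_gradient b d i y = 0.
Proof.
move=> d0 bal; rewrite RintegralZl//; last exact: integrable_skernel_gradient.
rewrite (@balance_Rintegral _ _ _ mOm (fun r => Num.max (r ^+ 2) d `^ (b / 2 - 1)))//.
- by rewrite mulr0.
- exact: measurable_max_enorm.
- by move=> t; exact: powR_ge0.
Qed.

End smooth_potential.

(** * Integrability of the singular kernel *)

Section rkernel_integrability.
Context (R : realType) (m : nat) (m0 : (0 < m)%N).
Notation lam := (lebesgue_rV R m).

Lemma measurable_eball0 (r : R) : measurable [set z : 'rV[R]_m | enorm z <= r].
Proof.
rewrite (_ : mkset _ = @enorm R m @^-1` `]-oo, r]%classic).
  by rewrite -[X in measurable X]setTI; apply: measurable_enorm.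
by apply/seteqP; split => x; rewrite /= in_itv.
Qed.

Lemma rkernel0 (b : R) : rkernel b 0 = 0.
Proof. by rewrite /rkernel; case: eqVneq => [_|b0]; [exact: ln0|exact: powR0]. Qed.

(** The inequality ln x <= x, applied to t and to t^(-1/2). Any exponent in ]-1, 0[ instead of -1/2
    would also be integrable at the origin in every dimension. *)
Lemma ln_norm_le (t : R) : 0 < t -> `|ln t| <= 2 * (t `^ (- 2^-1) + t).
Proof.
move=> t0.
have lnle (x : R) : 0 < x -> ln x <= x.
  by move=> x0; have := ln_sublinear x0; lra.
have h0 : 0 <= t `^ (- 2^-1) by exact: powR_ge0.
have : - ln t <= 2 * t `^ (- 2^-1).
  have -> : ln t = - 2 * ln (t `^ (- 2^-1)) by rewrite ln_powR; field.
  by rewrite mulNr opprK ler_wpM2l// lnle// powR_gt0.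
have := lnle t t0; rewrite ler_norml; lra.
Qed.

(** Two exponents make room for the logarithm: m - 1/2 is positive because m >= 1, and m + 1 takes
    care of large t. *)
Lemma rkernel_le_powR (b : R) : 0 < b + m%:R -> exists a1 a2 : R, [/\ 0 < a1, 0 < a2 &
  forall t, 0 < t -> `|rkernel b t| <= 2 * (t `^ (a1 - m%:R) + t `^ (a2 - m%:R))].
Proof.
move=> bm; rewrite /rkernel; have [b0|b0] := eqVneq b 0.
  have m1 : 1 <= m%:R :> R by rewrite ler1n.
  exists (m%:R - 2^-1), (m%:R + 1); split; [lra|lra|move=> t t0].
  have -> : m%:R - 2^-1 - m%:R = - 2^-1 :> R by lra.
  have -> : m%:R + 1 - m%:R = 1 :> R by lra.
  by rewrite [t `^ 1]powRr1 ?(ltW t0)//; exact: ln_norm_le t0.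
exists (b + m%:R), (b + m%:R); split => // t t0.
rewrite addrK ger0_norm ?powR_ge0//; have := powR_ge0 t b; lra.
Qed.

Lemma measurable_rkernel_enorm (b : R) :
  measurable_fun setT (fun z : 'rV[R]_m => rkernel b (enorm z)).
Proof. exact: (measurableT_comp (measurable_rkernel b) (@measurable_enorm R m)). Qed.

Lemma integrable_rkernel_ball (b r : R) : 0 < b + m%:R -> 0 < r ->
  lam.-integrable [set z | enorm z <= r] (fun z => (rkernel b (enorm z))%:E).
Proof.
move=> bm r0; apply/integrableP; split.
  by apply/measurable_EFinP/measurable_funTS; exact: measurable_rkernel_enorm.
have [a1 [a2 [a10 a20 Ha]]] := rkernel_le_powR bm.
(* Removing the origin changes nothing, as the kernel is 0 there by convention. *)
pose A := [set z : 'rV[R]_m | 0 < enorm z <= r].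
have mA : measurable A by exact: measurable_annulus.
rewrite [ltLHS](_ : _ = (\int[lam]_(z in A) `|(rkernel b (enorm z))%:E|)%E); last first.
  rewrite integral_mkcond [RHS]integral_mkcond; apply: eq_integral => z _.
  rewrite !patchE; have [z0|z0] := ltP 0 (enorm z).
    have -> // : (z \in [set z | enorm z <= r]) = (z \in A).
    by apply/idP/idP; rewrite !inE /A/= ?z0.
  have -> : enorm z = 0 by apply/eqP; rewrite eq_le z0 enorm_ge0.
  by rewrite rkernel0 abse0; case: ifP; case: ifP.
have mp a : measurable_fun A (fun z : 'rV[R]_m => (enorm z `^ (a - m%:R))%:E).
  exact: measurable_enorm_powR.
apply: (@le_lt_trans _ _ (\int[lam]_(z in A)
   (2%:E * ((enorm z `^ (a1 - m%:R))%:E + (enorm z `^ (a2 - m%:R))%:E)))%E).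
  apply: ge0_le_integral => //.
  - apply: measurableT_comp => //; apply/measurable_EFinP/measurable_funTS.
    exact: measurable_rkernel_enorm.
  - by apply: measurable_funeM; exact: emeasurable_funD.
  - by move=> z /andP[z0 _]; rewrite -EFinD -EFinM lee_fin; exact: Ha.
rewrite ge0_integralZl//; last 2 first.
- exact: emeasurable_funD.
- by move=> z _; rewrite -EFinD lee_fin addr_ge0// powR_ge0.
rewrite ge0_integralD//; [|by move=> z _; rewrite lee_fin powR_ge0..].
have H a : 0 < a -> (\int[lam]_(z in A) (enorm z `^ (a - m%:R))%:E < +oo)%E.
  by move=> a0; rewrite (le_lt_trans (integral_punctured_eball_le m0 a0 r0))// ltry.
by rewrite lte_mul_pinfty ?lee_fin// lte_add_pinfty// H.
Qed.

Lemma integrable_rkernel (b rho : R) (Om : set 'rV[R]_m) (x : 'rV[R]_m) :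
  0 < b + m%:R -> measurable Om -> (forall y, Om y -> enorm y <= rho) ->
  lam.-integrable Om (fun y => (rkernel b (enorm (x - y)))%:E).
Proof.
move=> bm mOm Omr.
pose r := enorm x + Num.max rho 1.
have r0 : 0 < r by rewrite ltr_wpDl ?enorm_ge0// lt_max ltr01 orbT.
have mx := measurable_reflect x.
have mB : measurable [set y | [set z : 'rV[R]_m | enorm z <= r] (x - y)].
  by rewrite -[X in measurable X]setTI; apply: mx => //; exact: measurable_eball0.
apply: (@integrableS _ _ _ _ [set y | [set z | enorm z <= r] (x - y)]) => //.
  move=> y /Omr yr /=; rewrite (le_trans (enormD _ _))// enormN lerD2l.
  by rewrite le_max yr.
have mk := measurable_rkernel_enorm b.
apply/integrableP; split.
  by apply/measurable_EFinP/measurable_funTS; exact: (measurableT_comp mk mx).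
have /integrableP[_] := integrable_rkernel_ball bm r0.
rewrite -(@integral_reflect_in _ _ x _ (fun z => `|(rkernel b (enorm z))%:E|)%E)//.
  exact: measurable_eball0.
by apply: measurableT_comp => //; exact/measurable_EFinP.
Qed.

End rkernel_integrability.

Lemma Rintegral_setD d (T : measurableType d) (R : realType)
    (mu : {measure set T -> \bar R}) (D A : set T) (f : T -> R) :
  measurable D -> measurable A -> A `<=` D -> mu.-integrable D (EFin \o f) ->
  \int[mu]_(x in D) f x = \int[mu]_(x in D `\` A) f x + \int[mu]_(x in A) f x.
Proof.
move=> mD mA AD fi.
have mDA : measurable (D `\` A) by exact: measurableD.
have UE : (D `\` A) `|` A = D by rewrite setUC setDUK.
rewrite -[in LHS]UE Rintegral_setU ?UE//.
by apply/disj_setPS => x [[_ nA]].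
Qed.

(** * Reduction to the smoothed kernel near the origin *)

Section potential_near.
Context (R : realType) (m : nat) (Om : set 'rV[R]_m) (mOm : measurable Om) (rho : R).
Hypotheses (m0 : (0 < m)%N) (Omr : forall x, Om x -> enorm x <= rho).
Notation lam := (lebesgue_rV R m).
Implicit Types (x : 'rV[R]_m) (al del : R).

(** At al = m the sign of m - al would be 0; the -1 is that of the logarithmic potential. The value
    is never 0, so it can be cancelled. *)
Definition potential_sign al : R :=
  if al <= 0 then 1 else if al == m%:R then -1 else Num.sg (m%:R - al).

Lemma potential_gt0 al x : 0 < al ->
  potential Om al x = potential_sign al * \int[lam]_(y in Om) rkernel (al - m%:R) (enorm (x - y)).
Proof.
move=> al0; rewrite /potential /potential_sign al0 leNgt al0/= /rkernel subr_eq0.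
by case: eqVneq => [_|_]; rewrite ?mulN1r.
Qed.

Lemma potential_sign_neq0 al : potential_sign al != 0.
Proof.
rewrite /potential_sign; case: ifP => _; first exact: oner_neq0.
case: ifPn => [_|alm]; first by rewrite lt_eqF ?ltrN10.
by rewrite sgr_eq0 subr_eq0 eq_sym.
Qed.

Lemma riesz_integralE al x (D : set 'rV[R]_m) : al <= 0 ->
  riesz_integral al D x = \int[lam]_(y in D) rkernel (al - m%:R) (enorm (x - y)).
Proof.
move=> al0; rewrite /riesz_integral /rkernel lt_eqF// subr_lt0.
by rewrite (le_lt_trans al0)// ltr0n.
Qed.

Lemma measurable_eball x del : measurable (eball x del).
Proof.
have := @measurable_reflect R m x measurableT _ (@measurable_eball0 R m del).
by rewrite setTI.
Qed.

Lemma Rintegral_eball x del (f : 'rV[R]_m -> R) : measurable_fun setT f ->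
  \int[lam]_(y in eball x del) f (x - y) = \int[lam]_(z in [set z | enorm z <= del]) f z.
Proof.
move=> mf; rewrite /Rintegral -(@integral_reflect_in _ _ x _ (EFin \o f))//.
  exact: measurable_eball0.
exact/measurable_EFinP.
Qed.

Lemma potential_exterior al : closed Om -> ~ Om 0 -> exists d s del c,
  [/\ 0 < d, 0 < del & forall x, enorm x < del ->
     potential Om al x = s * \int[lam]_(y in Om) skernel (al - m%:R) d (x - y) + c].
Proof.
move=> cO O0.
have /nbhs0_enorm[e e0 eO] : \forall x \near (0 : 'rV[R]_m), ~ Om x.
  by apply: open_nbhs_nbhs; split => //; exact: closed_openC.
(* Points of [Om] have norm at least e, so for |x| < e/2 they stay at distance e/2 from x, where the
   kernel is not smoothed. *)
exists ((e / 2) ^+ 2), (potential_sign al), (e / 2), 0.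
have e20 : 0 < e / 2 by exact: divr_gt0.
split => // [|x xe]; first by rewrite exprn_gt0.
have xO : ~ Om x by apply: eO; lra.
rewrite addr0 (@eq_Rintegral _ _ _ lam Om (fun y => rkernel (al - m%:R) (enorm (x - y)))); last first.
  move=> y; rewrite inE => Oy; rewrite skernelE// lerXn2r ?nnegrE ?enorm_ge0 ?(ltW e20)//.
  have ey : e <= enorm y by rewrite leNgt; apply/negP => /eO.
  by have := enormD (y - x) x; rewrite subrK [enorm (y - x)]enormBC; lra.
have [al0|al0] := leP al 0; last exact: potential_gt0.
rewrite /potential ltNge al0/= /potential_sign al0 mul1r asboolF ?riesz_integralE//.
by move=> /interior_subset.
Qed.

(** Smoothing acts only inside the ball around x, and after reflection the integral over that ball
    is independent of x. *)
Lemma skernel_integral_interior b del x : 0 < del -> eball x del `<=` Om ->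
  \int[lam]_(y in Om) skernel b (del ^+ 2) (x - y) =
  \int[lam]_(y in Om `\` eball x del) rkernel b (enorm (x - y)) +
  \int[lam]_(z in [set z | enorm z <= del]) skernel b (del ^+ 2) z.
Proof.
move=> del0 BO; have d0 : 0 < del ^+ 2 by rewrite exprn_gt0.
have ik := @integrable_skernel R m Om mOm rho Omr b (del ^+ 2) x Om d0 mOm (@subset_refl _ Om).
have -> := Rintegral_setD mOm (measurable_eball x del) BO ik.
rewrite Rintegral_eball; last exact: measurable_skernel.
congr (_ + _); apply: eq_Rintegral => y; rewrite inE => -[_ /negP].
rewrite -ltNge => dy; apply: skernelE.
by rewrite lerXn2r ?nnegrE ?enorm_ge0 ?(ltW del0)// ltW.
Qed.

Lemma counterterm_primitive al eps : al <= 0 -> 0 < eps ->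
  counterterm m al eps = - (sphere_area R m * radial_primitive al eps).
Proof.
move=> al0 e0; rewrite /counterterm /radial_primitive.
have [_|aln0] := eqVneq al 0; first by rewrite div1r lnV ?posrE// mulrN.
rewrite powRN; field.
by rewrite aln0 gt_eqF ?powR_gt0.
Qed.

(* The singular kernel over the annulus eps < |x - y| <= del is a primitive in eps
   that the counterterm cancels; replacing the kernel by the smoothed one inside
   the ball of radius del therefore only adds a constant. *)
Lemma potential_interior al : Om° 0 -> exists d s del c,
  [/\ 0 < d, 0 < del & forall x, enorm x < del ->
     potential Om al x = s * \int[lam]_(y in Om) skernel (al - m%:R) d (x - y) + c].
Proof.
move=> /nbhs_interior /nbhs0_enorm[e e0 eOi].
have eO y : enorm y < e -> Om y by move=> /eOi; exact: interior_subset.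
pose del := e / 2; have del0 : 0 < del by exact: divr_gt0.
have cancel1 (I1 I2 c1 : R) : I1 + I2 = I1 + c1 + (I2 - c1) by lra.
have cancel2 (I1 A P Q c1 : R) : I1 + A * (P - Q) + A * Q = I1 + c1 + (A * P - c1) by lra.
have [b bE] : exists b, b = al - m%:R by exists (al - m%:R).
have [c1 c1E] : exists c, c = \int[lam]_(z in [set z | enorm z <= del]) skernel b (del ^+ 2) z.
  by eexists.
have BO x : enorm x < del -> eball x del `<=` Om.
  move=> xd y /= yd; apply: eO.
  have yd' : enorm (x - y) <= e / 2 := yd; have xd' : enorm x < e / 2 := xd.
  by have := enormD (y - x) x; rewrite subrK [enorm (y - x)]enormBC; lra.
pose s := potential_sign al.
(* The smoothed contribution [c1] of the ball is exchanged for the true one: the integral of the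
   kernel if al > 0, its finite part, given by the primitive at [del], if al <= 0. *)
pose c := if 0 < al then s * (\int[lam]_(z in [set z | enorm z <= del]) rkernel b (enorm z) - c1)
  else sphere_area R m * radial_primitive al del - c1.
exists (del ^+ 2), s, del, c; split => //; first by rewrite exprn_gt0.
move=> x xd; rewrite -bE skernel_integral_interior//; last exact: BO.
rewrite -c1E /c.
case: ltP => al0.
  rewrite potential_gt0// -bE -mulrDr; congr (_ * _).
  have ik : lam.-integrable Om (EFin \o (fun y => rkernel b (enorm (x - y)))).
    by apply: integrable_rkernel Omr => //; rewrite bE subrK.
  have -> := Rintegral_setD mOm (measurable_eball x del) (BO x xd) ik.
  have -> := @Rintegral_eball x del (fun z => rkernel b (enorm z))
    (measurable_rkernel_enorm b).
  exact: cancel1.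
have xO : Om° x by apply: eOi; move: xd; rewrite /del; lra.
rewrite /s /potential_sign al0 mul1r /potential ltNge al0/= asboolT//.
(* For eps < del the expression under the limit does not depend on eps. *)
apply: lim_near_cst => //.
near=> eps.
have eps0 : 0 < eps by [].
have epsd : eps < del by near: eps; exact: nbhs_right_lt.
have bn0 : b == 0 = false by rewrite bE lt_eqF// subr_lt0 (le_lt_trans al0)// ltr0n.
rewrite riesz_integralE// counterterm_primitive// opprK -bE.
have mBx := measurable_eball x del; have mBe := measurable_eball x eps.
have mA : measurable (eball x del `\` eball x eps) by exact: measurableD.
have mOe : measurable (Om `\` eball x eps) by exact: measurableD.
have ik : lam.-integrable (Om `\` eball x eps) (EFin \o (fun y => rkernel b (enorm (x - y)))).
  (* Off the ball of radius eps the kernel is its own smoothing at threshold eps^2, which is bounded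
     on [Om]. *)
  apply: (@eq_integrable _ _ _ _ _ mOe (EFin \o (fun y => skernel b (eps ^+ 2) (x - y)))).
    move=> y; rewrite inE => -[_ /negP]; rewrite -ltNge => ey; congr EFin; apply: skernelE.
    by rewrite lerXn2r ?nnegrE ?enorm_ge0 ?(ltW eps0)// ltW.
  by apply: (integrable_skernel mOm Omr) => //; exact: exprn_gt0.
have sub : eball x del `\` eball x eps `<=` Om `\` eball x eps by apply: setSD; exact: BO.
have -> := Rintegral_setD mOe mA sub ik.
have -> : (Om `\` eball x eps) `\` (eball x del `\` eball x eps) = Om `\` eball x del.
  apply/seteqP; split=> y.
    by move=> [[Oy ye] H]; split => // yd; apply: H.
  move=> [Oy yd]; split; last by move=> [].
  by split => // ye; apply: yd; rewrite /eball/= in ye *; rewrite (le_trans ye)// ltW.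
have -> : \int[lam]_(y in eball x del `\` eball x eps) rkernel b (enorm (x - y)) =
    sphere_area R m * (radial_primitive al del - radial_primitive al eps).
  have -> : eball x del `\` eball x eps = [set y | [set z : 'rV[R]_m | eps < enorm z <= del] (x - y)].
    apply/seteqP; split=> y; rewrite /eball/=.
      by move=> [-> /negP]; rewrite -ltNge andbT.
    by move=> /andP[ey yd]; split => //; apply/negP; rewrite -ltNge.
  rewrite /Rintegral (@integral_reflect_in _ _ x _ (fun z => (rkernel b (enorm z))%:E)).
  - under eq_integral do rewrite /rkernel bn0.
    by rewrite bE integral_annulus.
  - exact: measurable_annulus.
  - by apply/measurable_EFinP; exact: measurable_rkernel_enorm.
exact: cancel2.
Unshelve. all: by end_near.
Qed.

End potential_near.

(** * Potentials of order greater than one *)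

Lemma is_derive_rkernel (R : realType) (b t : R) : 0 < t ->
  is_derive t 1 (rkernel b) (rcoef b * t `^ (b - 1)).
Proof.
move=> t0; rewrite /rkernel /rcoef; have [->|b0] := eqVneq b 0.
  by rewrite mul1r sub0r powR_inv1 ?ltW//; exact: is_derive1_ln.
exact: is_derive1_powR.
Qed.

Lemma rkernel_lipschitz (R : realType) (b u v : R) : 0 < u -> 0 < v ->
  `|rkernel b u - rkernel b v| <= `|rcoef b| * `|u - v| * (u `^ (b - 1) + v `^ (b - 1)).
Proof.
move=> u0 v0.
wlog uv : u v u0 v0 / v <= u.
  move=> H; have [vu|/ltW uv] := leP v u; first exact: H.
  by rewrite distrC [`|u - v|]distrC [u `^ _ + _]addrC; exact: H.
have vi : v <= v <= u by rewrite lexx.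
have ui : v <= u <= u by rewrite uv lexx.
have dk x : v <= x <= u -> is_derive x 1 (rkernel b) (rcoef b * x `^ (b - 1)).
  by move=> /andP[vx _]; apply: is_derive_rkernel; exact: lt_le_trans vx.
have [c [cvu _ _ ->]] := MVT_between vi ui dk.
rewrite !normrM mulrAC -!mulrA ler_wpM2l// ler_wpM2l//.
by rewrite ger0_norm ?powR_ge0// [leRHS]addrC; exact: powR_le_ends.
Qed.

Section singular_potential.
Context (R : realType) (m : nat) (Om : set 'rV[R]_m) (mOm : measurable Om) (rho : R).
Hypotheses (m0 : (0 < m)%N) (Omr : forall x, Om x -> enorm x <= rho).
Notation lam := (lebesgue_rV R m).

Let Omoo : (lam Om < +oo)%E. Proof. exact: lebesgue_rV_bounded Omr. Qed.

(** Up to [rcoef b], the size of the kernel's gradient near the singularity. For b = al - m, the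
    condition [0 < b - 1 + m%:R] for its integrability reads al > 1. *)
Definition ball_weight (b r : R) : 'rV[R]_m -> \bar R :=
  (fun z => (enorm z `^ (b - 1))%:E) \_ [set z | 0 < enorm z <= r].

Lemma ball_weight_ge0 b r z : (0 <= ball_weight b r z)%E.
Proof. by apply: erestrict_ge0 => t _; rewrite lee_fin powR_ge0. Qed.

Lemma measurable_ball_weight b r : measurable_fun setT (ball_weight b r).
Proof.
apply: (measurable_restrictT _ _).1; first exact: measurable_annulus.
exact: measurable_enorm_powR.
Qed.

Lemma ball_weightE b r z : 0 < enorm z <= r -> ball_weight b r z = (enorm z `^ (b - 1))%:E.
Proof. by move=> zr; rewrite /ball_weight patchE mem_set. Qed.

Lemma integral_ball_weight_le b r (D : set 'rV[R]_m) : measurable D ->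
  0 < b - 1 + m%:R -> 0 < r ->
  (\int[lam]_(z in D) ball_weight b r z <=
   (sphere_area R m * (r `^ (b - 1 + m%:R) / (b - 1 + m%:R)))%:E)%E.
Proof.
move=> mD b1 r0.
apply: (@le_trans _ _ (\int[lam]_z ball_weight b r z)%E).
  apply: ge0_subset_integral => //.
  - exact: measurable_ball_weight.
  - by move=> z _; exact: ball_weight_ge0.
rewrite -integral_mkcond; have := integral_punctured_eball_le m0 b1 r0.
by rewrite addrK.
Qed.

Definition rkernel_gradient (b : R) (i : 'I_m) (y : 'rV[R]_m) : R :=
  - rcoef b * (enorm y `^ (b - 2) * y 0 i).

Lemma measurable_enorm_pow b : measurable_fun setT (fun y : 'rV[R]_m => enorm y `^ b).
Proof. exact: (measurableT_comp (measurable_powR b) (@measurable_enorm R m)). Qed.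

Lemma powR_mul_self (b t : R) : 0 < t -> t `^ (b - 2) * t = t `^ (b - 1).
Proof.
move=> t0; rewrite -[X in _ * X]powRr1 ?ltW// -powRD; last by rewrite (gt_eqF t0) implybT.
by congr (_ `^ _); lra.
Qed.

Lemma integrable_enorm_pow_coord b i : 0 < b - 1 + m%:R ->
  lam.-integrable Om (EFin \o (fun y : 'rV[R]_m => enorm y `^ (b - 2) * y 0 i)).
Proof.
move=> b1.
pose r := Num.max rho 1.
have r0 : 0 < r by rewrite lt_max ltr01 orbT.
have mg : measurable_fun Om (fun y : 'rV[R]_m => enorm y `^ (b - 2) * y 0 i).
  apply: measurable_funTS; apply: measurable_funM; last exact: measurable_rV_coord.
  exact: measurable_enorm_pow.
apply/integrableP; split; first exact/measurable_EFinP.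
apply: le_lt_trans (ltry _); apply: le_trans (integral_ball_weight_le mOm b1 r0).
apply: ge0_le_integral => //.
- by apply: measurableT_comp => //; exact/measurable_EFinP.
- by apply: measurable_funTS; exact: measurable_ball_weight.
- move=> y Oy; have [->|y0] := eqVneq y 0.
    by rewrite /= mxE mulr0 normr0 ball_weight_ge0.
  have ey : 0 < enorm y by rewrite enorm_gt0.
  rewrite ball_weightE; last by rewrite ey/= le_max Omr.
  rewrite lee_fin normrM ger0_norm ?powR_ge0// -powR_mul_self//.
  by rewrite ler_wpM2l ?powR_ge0// coord_le_enorm.
Qed.

(* Near the singularity the error is controlled by the Lipschitz bound of the
   kernel, and away from it by the Taylor bound of the smoothed kernel. *)
Lemma rkernel_error_le b eta C (h y : 'rV[R]_m) :
  0 < eta -> 0 <= C ->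
  (forall y h : 'rV[R]_m, enorm y <= rho -> enorm h <= 1 ->
    `|skernel b (eta ^+ 2) (h - y) - skernel b (eta ^+ 2) (0 - y)
     + 2 * dsqkernel b (Num.max (enorm y ^+ 2) (eta ^+ 2)) * dotv h y| <= C * enorm h ^+ 2) ->
  enorm h <= 1 -> enorm h <= eta -> enorm y <= rho -> y != 0 -> h != y ->
  (`|rkernel b (enorm (h - y)) - rkernel b (enorm (0 - y))
    - \sum_(i < m) h ord0 i * rkernel_gradient b i y|%:E <=
  (`|rcoef b| * enorm h)%:E *
    (ball_weight b (3 * eta) (h - y) + (ball_weight b (3 * eta) y + ball_weight b (3 * eta) y))
  + (C * enorm h ^+ 2)%:E)%E.
Proof.
move=> eta0 C0 HC h1 heta yr y0 hy.
have ey : 0 < enorm y by rewrite enorm_gt0.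
have ehy : 0 < enorm (h - y) by rewrite enorm_gt0 subr_eq0.
have sumE : \sum_(i < m) h ord0 i * rkernel_gradient b i y =
    - (rcoef b * enorm y `^ (b - 2) * dotv h y).
  rewrite /dotv mulr_sumr -sumrN; apply: eq_bigr => i _.
  by rewrite /rkernel_gradient; ring.
rewrite sumE opprK sub0r enormN.
(* With |h| <= eta, far points keep |h - y| >= eta, so neither kernel is smoothed; near ones have |h
   - y| <= 3 eta, whence the radius of the weights. *)
have [far|near] := ltP (2 * eta) (enorm y).
  have hye : eta <= enorm (h - y).
    by have := enormD (y - h) h; rewrite subrK [enorm (y - h)]enormBC; lra.
  have := HC y h yr h1.
  rewrite !skernelE ?sub0r ?enormN; last 2 first.
  - by rewrite lerXn2r ?nnegrE ?enorm_ge0 ?(ltW eta0)//; lra.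
  - by rewrite lerXn2r ?nnegrE ?enorm_ge0 ?(ltW eta0)//.
  have -> : Num.max (enorm y ^+ 2) (eta ^+ 2) = enorm y ^+ 2.
    by apply/max_idPl; rewrite lerXn2r ?nnegrE ?enorm_ge0 ?(ltW eta0)//; lra.
  have -> : 2 * dsqkernel b (enorm y ^+ 2) = rcoef b * enorm y `^ (b - 2).
    rewrite /dsqkernel -powR_mulrn ?enorm_ge0// -powRrM.
    rewrite (_ : 2%:R * (b / 2 - 1) = b - 2); last by field.
    by field.
  move=> H; rewrite -[leLHS]add0e; apply: leeD; last by rewrite lee_fin.
  by rewrite mule_ge0 ?lee_fin ?mulr_ge0 ?enorm_ge0// !adde_ge0// ball_weight_ge0.
have hye : enorm (h - y) <= 3 * eta.
  by rewrite (le_trans (enormD _ _))// enormN; lra.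
rewrite !ball_weightE; last 2 first.
- by rewrite ey/=; lra.
- by rewrite ehy.
set A := enorm (h - y) `^ _; set B := enorm y `^ (b - 1).
rewrite -[leRHS]/((`|rcoef b| * enorm h * (A + (B + B)) + C * enorm h ^+ 2)%:E) lee_fin.
apply: (le_trans (ler_normD _ _)); rewrite -[leLHS]addr0.
apply: lerD; last by rewrite mulr_ge0// sqr_ge0.
have E1 := rkernel_lipschitz b ehy ey.
have E2 : `|enorm (h - y) - enorm y| <= enorm h.
  have := enorm_dist (h - y) (- y); rewrite enormN opprK subrK; exact.
(* The difference of kernels costs one weight at h - y and one at y; the linear term costs the
   second weight at y. *)
have E3 : `|rkernel b (enorm (h - y)) - rkernel b (enorm y)| <=
   `|rcoef b| * enorm h * (enorm (h - y) `^ (b - 1) + enorm y `^ (b - 1)).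
  apply: (le_trans E1); rewrite ler_wpM2r ?addr_ge0 ?powR_ge0// ler_wpM2l//.
have E4 : `|rcoef b * enorm y `^ (b - 2) * dotv h y| <=
   `|rcoef b| * enorm h * enorm y `^ (b - 1).
  rewrite -powR_mul_self// !normrM (ger0_norm (powR_ge0 _ _)) -!mulrA ler_wpM2l//.
  rewrite mulrCA ler_wpM2l ?powR_ge0//; exact: dotv_le.
rewrite -/A -/B in E3 E4 *.
by rewrite addrA mulrDr; exact: lerD.
Qed.

Lemma rkernel_potential_diff b : 0 < b - 1 + m%:R ->
  enorm_diff (fun x => \int[lam]_(y in Om) rkernel b (enorm (x - y)))
    (\row_i \int[lam]_(y in Om) rkernel_gradient b i y).
Proof.
move=> b1.
have ik x : lam.-integrable Om (EFin \o (fun y => rkernel b (enorm (x - y)))).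
  by apply: (@integrable_rkernel _ _ m0 b rho Om x) => //; lra.
apply: enorm_diff_integral => //.
  move=> i; have := integrableZl mOm (- rcoef b) (integrable_enorm_pow_coord i b1).
  exact: eq_integrable.
move=> e e0.
have [a aE] : exists a, a = b - 1 + m%:R by eexists.
have a0 : 0 < a by rewrite aE.
have [S SE] : exists S, S = sphere_area R m / a by eexists.
have S0 : 0 <= S by rewrite SE divr_ge0 ?sphere_area_ge0 ?ltW.
(* Each of the three weights has integral at most S (3 eta)^a. *)
pose K := `|rcoef b| * (3 * S).
have K0 : 0 <= K by rewrite mulr_ge0// mulr_ge0.
have [eta eta0 etaK] : exists2 eta, 0 < eta & K * (3 * eta) `^ a <= e / 2.
  have t0 : 0 < e / 2 / (K + 1) by rewrite divr_gt0 ?divr_gt0// ltr_wpDl.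
  exists ((e / 2 / (K + 1)) `^ a^-1 / 3); first by rewrite divr_gt0// powR_gt0.
  rewrite mulrCA divff// mulr1 -powRrM mulVf ?gt_eqF// powRr1 ?(ltW t0)//.
  rewrite mulrCA ler_piMr ?divr_ge0 ?(ltW e0)// ler_pdivrMr ?mul1r ?lerDl//.
  by rewrite ltr_wpDl.
(* [C] depends on [eta], so the bound on h can only be chosen after both; half of e goes to the
   weights, half to the quadratic term. *)
have [C C0 HC] := @skernel_taylor R m b (eta ^+ 2) rho (exprn_gt0 2 eta0).
pose l := fine (lam Om).
have l0 : 0 <= l by rewrite fine_ge0.
have lE : lam Om = l%:E by rewrite fineK// ge0_fin_numE.
have Cl : 0 < C * l + 1 by rewrite ltr_wpDl// mulr_ge0.
exists (Num.min (Num.min 1 eta) (e / 2 / (C * l + 1))).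
  by rewrite !lt_min ltr01 eta0 !divr_gt0.
move=> h; rewrite !lt_min => /andP[/andP[h1 heta] he]; split=> //.
pose W := ball_weight b (3 * eta).
have m1 (x : 'rV[R]_m) : measurable [set x].
  by apply: closed_measurable_rV; apply: accessible_closed_set1; exact: hausdorff_accessible.
have mW D : measurable_fun D W by apply: measurable_funTS; exact: measurable_ball_weight.
have mWh : measurable_fun setT (fun y : 'rV[R]_m => W (h - y)%R).
  exact: (measurableT_comp (mW setT) (measurable_reflect h)).
have mWhD D : measurable_fun D (fun y : 'rV[R]_m => W (h - y)%R) by exact: measurable_funTS.
have W0 z : (0 <= W z)%E by exact: ball_weight_ge0.
have mS : measurable_fun Om (fun y : 'rV[R]_m => W (h - y)%R + (W y + W y))%E.
  by apply: emeasurable_funD => //; exact: emeasurable_funD.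
have r0 : 0 <= `|rcoef b| * enorm h by rewrite mulr_ge0 ?enorm_ge0.
have C1 : 0 <= C * enorm h ^+ 2 by rewrite mulr_ge0 ?sqr_ge0.
have W3 y : (0 <= W (h - y)%R + (W y + W y))%E by apply: adde_ge0 => //; exact: adde_ge0.
have W4 y : (0 <= (`|rcoef b| * enorm h)%:E * (W (h - y)%R + (W y + W y)))%E.
  exact: mule_ge0.
have Wge0 y : (0 <= (`|rcoef b| * enorm h)%:E * (W (h - y)%R + (W y + W y))
   + (C * enorm h ^+ 2)%:E)%E by exact: adde_ge0.
exists (fun y : 'rV[R]_m => (`|rcoef b| * enorm h)%:E * (W (h - y)%R + (W y + W y))
                 + (C * enorm h ^+ 2)%:E)%E; split.
- by apply: emeasurable_funD => //; exact: measurable_funeM.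
- by move=> y _; exact: Wge0.
- exists ([set 0] `|` [set h]); split.
  + by apply: measurableU; exact: m1.
  + by apply: (null_set_setU (m1 0) (m1 h)); exact: lebesgue_rV_set1.
  + move=> y /= H; apply: contrapT => /not_orP[y0 yh]; apply: H => Oy.
    apply: rkernel_error_le => //.
    * exact: ltW.
    * exact: ltW.
    * exact: Omr.
    * exact/eqP.
    * by apply/eqP => hy; apply: yh.
rewrite ge0_integralD//; last exact: measurable_funeM.
rewrite ge0_integralZl//.
rewrite ge0_integralD//; last 2 first.
- by move=> y _; exact: adde_ge0.
- exact: emeasurable_funD.
rewrite ge0_integralD// integral_cst// [X in (_ + _ * X)%E]lE.
have I1 : (\int[lam]_(y in Om) W y <= (S * (3 * eta) `^ a)%:E)%E.
  have := integral_ball_weight_le mOm b1 (mulr_gt0 (ltr0Sn R 2) eta0).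
  by rewrite -aE SE mulrAC mulrA.
(* Enlarging the domain to the whole space lets reflection remove the dependence on h. *)
have I2 : (\int[lam]_(y in Om) W (h - y)%R <= (S * (3 * eta) `^ a)%:E)%E.
  apply: (@le_trans _ _ (\int[lam]_(y in [set: 'rV[R]_m]) W (h - y)%R)%E).
    exact: ge0_subset_integral.
  rewrite (ge0_integral_reflect h (mW setT) W0).
  have := integral_ball_weight_le measurableT b1 (mulr_gt0 (ltr0Sn R 2) eta0).
  by rewrite -aE SE mulrAC mulrA.
apply: (@le_trans _ _ ((`|rcoef b| * enorm h)%:E * ((S * (3 * eta) `^ a)%:E +
   ((S * (3 * eta) `^ a)%:E + (S * (3 * eta) `^ a)%:E)) + (C * enorm h ^+ 2)%:E * l%:E)%E).
  by apply: (leeD (lee_wpmul2l _ (leeD I2 (leeD I1 I1))) (lexx _)); rewrite lee_fin.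
rewrite lee_fin; set P := _ `^ a in etaK *.
have H1 : K * P * enorm h <= e / 2 * enorm h by rewrite ler_wpM2r ?enorm_ge0.
have H2 : C * l * enorm h <= e / 2.
  move: he; rewrite ltr_pdivlMr// mulrC => /ltW; apply: le_trans.
  by rewrite ler_wpM2r ?enorm_ge0// lerDl.
have H3 : C * l * enorm h * enorm h <= e / 2 * enorm h by rewrite ler_wpM2r ?enorm_ge0.
rewrite (_ : _ + _ = K * P * enorm h + C * l * enorm h * enorm h).
  by rewrite (le_trans (lerD H1 H3))// -mulrDl -splitr.
by rewrite /K; ring.
Qed.

End singular_potential.

(** * Critical points *)

Lemma bounded_closure (R : realType) (m : nat) (U : set 'rV[R]_m) :
  bounded_set U -> exists2 rho, 0 < rho & forall x, closure U x -> enorm x <= rho.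
Proof.
move=> /ex_strict_bound_gt0[M M0 MU].
exists (m%:R * M + 1); first by rewrite ltr_wpDl// mulr_ge0// ltW.
have cM : closed [set x : 'rV[R]_m | `|x| <= M].
  apply: (@preimage_closed _ _ (fun x : 'rV[R]_m => `|x|) [set r | r <= M]).
    by move=> x _; exact: norm_continuous.
  exact: closed_le.
have UM : U `<=` [set x | `|x| <= M] by move=> x /MU /ltW.
move=> x /(closure_subset UM); rewrite -((closure_id _).1 cM) /= => xM.
by rewrite (le_trans (enorm_le_norm x))// (le_trans (ler_wpM2l _ xM))// lerDl.
Qed.

Section critical_points.
Context (R : realType) (m : nat) (Om : set 'rV[R]_m) (mOm : measurable Om) (rho : R).
Hypotheses (m0 : (0 < m)%N) (rho0 : 0 < rho) (Omr : forall x, Om x -> enorm x <= rho).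
Notation lam := (lebesgue_rV R m).

Lemma enorm_diff_critical (V : 'rV[R]_m -> R) xi : enorm_diff V xi ->
  critical_point V 0 <-> xi = 0.
Proof.
move=> /enorm_diffP[dV D]; split => [[_ V0]|xi0]; last first.
  by split => // i; rewrite D xi0 mxE.
by apply/rowP => i; rewrite -D V0 mxE.
Qed.

Lemma potential_diff al : 1 < al -> enorm_diff (potential Om al)
  (potential_sign m al *: \row_i \int[lam]_(y in Om) rkernel_gradient (al - m%:R) i y).
Proof.
move=> al1.
have b1 : 0 < al - m%:R - 1 + m%:R by rewrite addrAC subrK subr_gt0.
apply: (enorm_diff_near ltr01 _ (rkernel_potential_diff mOm m0 Omr b1) (c := 0)).
by move=> x _; rewrite addr0 potential_gt0// (lt_trans ltr01).
Qed.

Lemma balance_critical_gt1 al : 1 < al -> balance_law Om ->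
  critical_point (potential Om al) 0.
Proof.
move=> al1 bal; apply/(enorm_diff_critical (potential_diff al1)).
apply/rowP => i; rewrite !mxE RintegralZl//; last first.
  by apply: (integrable_enorm_pow_coord mOm m0 Omr); rewrite addrAC subrK subr_gt0.
rewrite (@balance_Rintegral _ _ _ mOm (fun r => r `^ (al - m%:R - 2)))// ?mulr0//.
by move=> t; exact: powR_ge0.
Qed.

Lemma balance_critical al : closed Om -> ~ boundary Om 0 -> balance_law Om ->
  critical_point (potential Om al) 0.
Proof.
move=> cO bO bal.
have [d [s [del [c [d0 del0 V]]]]] : exists d s del c,
    [/\ 0 < d, 0 < del & forall x, enorm x < del ->
     potential Om al x = s * \int[lam]_(y in Om) skernel (al - m%:R) d (x - y) + c].
  (* [Om] is closed, so off the boundary the origin is exterior or interior. *)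
  have [Om0|Om0] := pselect (Om 0); last exact: (potential_exterior m0).
  apply: (potential_interior mOm m0 Omr).
  by apply: contrapT => iO; apply: bO; split => //; exact: subset_closure.
apply/(enorm_diff_critical
  (enorm_diff_near del0 V (skernel_potential_diff mOm Omr _ d0))).
by apply/rowP => i; rewrite !mxE (balance_skernel_gradient mOm m0 Omr) // mulr0.
Qed.

Lemma critical_balance :
  (forall n, critical_point (potential Om (m%:R + n.*2.+2%:R)) 0) -> balance_law Om.
Proof.
move=> H; apply: (moments_balance mOm m0 rho0 Omr) => n i.
have al1 : 1 < m%:R + n.*2.+2%:R :> R by rewrite -natrD ltr1n !addnS.
have /rowP/(_ i) := (enorm_diff_critical (potential_diff al1)).1 (H n).
have b1 : 0 < m%:R + n.*2.+2%:R - m%:R - 1 + m%:R :> R by rewrite addrAC subrK subr_gt0.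
rewrite !mxE RintegralZl//; last exact: (integrable_enorm_pow_coord mOm m0 Omr).
move=> /eqP; rewrite mulf_eq0 (negbTE (potential_sign_neq0 _ _))/=.
(* Here b = 2n + 2: the factor [rcoef b] is not 0 and can be cancelled, and |y|^(b-2) is the even
   power |y|^(2n). *)
rewrite [m%:R + _]addrC addrK mulf_eq0 oppr_eq0 /rcoef pnatr_eq0/= pnatr_eq0/= => /eqP.
move=> I; rewrite -[RHS]I; apply: eq_Rintegral => x _.
by rewrite -[n.*2.+2]addn2 natrD addrK powR_mulrn ?enorm_ge0.
Qed.

End critical_points.

Theorem theorem3p2 (R : realType) (m : nat) (m_gt0 : (0 < m)%N)
    (Om : set 'rV[R]_m) (body_Om : body Om) :
  ((forall alpha : R, 1 < alpha -> critical_point (potential Om alpha) 0)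
     <-> balance_law Om)
  /\
  (~ boundary Om 0 ->
    ((forall alpha : R, ~ (0 <= alpha <= 1) ->
        critical_point (potential Om alpha) 0)
       <-> balance_law Om))
  /\
  (piecewise_C1 (boundary Om) -> ~ boundary Om 0 ->
    ((forall alpha : R, critical_point (potential Om alpha) 0)
       <-> balance_law Om)).

Proof.
have [U [oU bU OmU]] := body_Om.
have cO : closed Om by rewrite OmU; exact: closed_closure.
have mO := closed_measurable_rV cO.
have [rho rho0 Omr] := bounded_closure bU; rewrite -OmU in Omr.
have al1 n : 1 < m%:R + n.*2.+2%:R :> R by rewrite -natrD ltr1n !addnS.
(* The orders m + 2n + 2 exceed 1, so they are among those considered in each of the three parts,
   and one argument yields the balance law in all of them. *)
have crit := critical_balance mO m_gt0 rho0 Omr.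
split; last split.
- split => [H|bal al al_gt1]; first by apply: crit => n; exact: H.
  exact: (balance_critical_gt1 mO m_gt0 Omr).
- move=> bO; split => [H|bal al _].
    by apply: crit => n; apply: H => /andP[_]; rewrite leNgt al1.
  exact: (balance_critical mO m_gt0 Omr).
- move=> _ bO; split => [H|bal al]; first by apply: crit => n; exact: H.
  exact: (balance_critical mO m_gt0 Omr).
Qed.
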